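(* Let $(A,\{\!\!\{-,-\}\!\!\})$ be a double quasi-Poisson algebra over the semisimple algebra $A_0=\oplus_{s\in I}\mathbb{C}e_s$. Assume that $\phi:A\to A$ is an involutive $\mathbb{C}$-linear anti-automorphism with $\phi(e_s)=e_s$ for all $s\in I$ and $(\phi\otimes\phi)(\{\!\!\{a,b\}\!\!\})=\{\!\!\{\phi(a),\phi(b)\}\!\!\}^\circ$ for all $a,b\in A$. For any dimension vector $\alpha\in2\mathbb{N}^I$, $N=\sum_{s\in I}\alpha_s$, considering the involution $\tau:\xi\mapsto\Omega\xi^T\Omega^T$ on $\mathfrak{gl}_N$, the antisymmetric biderivation $\{-,-\}_{\phi,\mathrm{Sp}}$ on $\mathrm{Rep}^{\phi,\tau}(A,\alpha)$ uniquely determined by $$\{a_{ij},b_{kl}\}_{\phi,\mathrm{Sp}}=\tfrac12\{\!\!\{a,b\}\!\!\}_{kj,il}+\tfrac12\,\mathrm{sgn}_\alpha(i,j)\,\{\!\!\{\phi(a),b\}\!\!\}_{k\tau(i),\tau(j)l},\qquad a,b\in A,\ 1\le i,j,k,l\le N,$$ is a quasi-Poisson bracket for the action of $\mathrm{Sp}_\alpha:=\prod_{s\in I}\mathrm{Sp}(\alpha_s)$. Furthermore, if $\Phi\in A^\times$ is a moment map (for $\{\!\!\{-,-\}\!\!\}$) chosen to satisfy $\phi(\Phi)\,\Phi=1$, then $\mathtt{X}(\Phi):\mathrm{Rep}^{\phi,\tau}(A,\alpha)\to\mathrm{Sp}_\alpha$ is a moment map for $\{-,-\}_{\phi,\mathr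m{Sp}}$.
   Context: Algebras are finitely generated, associative, unital over $\mathbb{C}$; $\otimes=\otimes_{\mathbb{C}}$. $I=\{1,\dots,|I|\}$ is finite, $A_0=\oplus_{s\in I}\mathbb{C}e_s$ with $e_se_t=\delta_{st}e_s$, $\sum_se_s=1$, and $A$ is an algebra over $A_0$. Double brackets. Write $d=d'\otimes d''\in A\otimes A$; $(d'\otimes d'')^\circ=d''\otimes d'$; $a\,d\,b=ad'\otimes d''b$; $a\ast d\ast b=d'b\otimes ad''$. A double bracket is a $\mathbb{C}$-bilinear map $\{\!\!\{-,-\}\!\!\}:A\times A\to A\otimes A$ with $\{\!\!\{a,b\}\!\!\}=-\{\!\!\{b,a\}\!\!\}^\circ$, $\{\!\!\{a,bc\}\!\!\}=\{\!\!\{a,b\}\!\!\}c+b\{\!\!\{a,c\}\!\!\}$, $\{\!\!\{bc,a\}\!\!\}=\{\!\!\{b,a\}\!\!\}\ast c+b\ast\{\!\!\{c,a\}\!\!\}$, and $\{\!\!\{e,a\}\!\!\}=0=\{\!\!\{a,e\}\!\!\}$ for $e\in A_0$. With $\{\!\!\{a,d\}\!\!\}_L=\{\!\!\{a,d'\}\!\!\}\otimes d''$ and $\tau_{(123)}(a_1\otimes a_2\otimes a_3)=a_3\otimes a_1\otimes a_2$, put $\{\!\!\{a,b,c\}\!\!\}=\{\!\!\{a,\{\!\!\{b,c\}\!\!\}\}\!\!\}_L+\tau_{(123)}\{\!\!\{b,\{\!\!\{c,a\}\!\!\}\}\!\!\}_L+\tau_{(123)}^2\{\!\!\{c,\{\!\!\{a,b\}\!\!\}\}\!\!\}_L$.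 It is quasi-Poisson if for all $a,b,c\in A$ $$\{\!\!\{a,b,c\}\!\!\}=\tfrac14\sum_{s\in I}\big(ce_sa\otimes e_sb\otimes e_s-ce_sa\otimes e_s\otimes be_s-ce_s\otimes ae_sb\otimes e_s+ce_s\otimes ae_s\otimes be_s-e_sa\otimes e_sb\otimes e_sc+e_sa\otimes e_s\otimes be_sc+e_s\otimes ae_sb\otimes e_sc-e_s\otimes ae_s\otimes be_sc\big).$$ A moment map is an invertible $\Phi=\sum_s\Phi_s$, $\Phi_s\in e_sAe_s$, with $\{\!\!\{\Phi_s,a\}\!\!\}=\frac12(ae_s\otimes\Phi_s-e_s\otimes\Phi_sa+a\Phi_s\otimes e_s-\Phi_s\otimes e_sa)$ for all $a\in A$, $s\in I$. Symplectic notation. $\Omega=\mathrm{diag}(\Omega_{\alpha_1},\dots,\Omega_{\alpha_{|I|}})$ with $\Omega_{2d}=\begin{pmatrix}0_d&\mathrm{Id}_d\\-\mathrm{Id}_d&0_d\end{pmatrix}$; $\mathrm{Sp}(\alpha_s)$ preserves $\Omega_{\alpha_s}$. Let $\mathtt{R}_s=\{\alpha_1+\dots+\alpha_{s-1}+1,\dots,\alpha_1+\dots+\alpha_s\}$. For $k\in\mathtt{R}_s$, $\mathrm{sgn}_\alpha(k)=+1$ if $k-\sum_{t<s}\alpha_t\le\alpha_s/2$, $\mathrm{sgn}_\alpha(k)=-1$ otherwise, and $\tau(k)=k+\frac12\mathrm{sgn}_\alpha(k)\alpha_s$. Put $\mathrm{sgn}_\alpha(i,j)=\mathrm{sgn}_\alpha(i)\,\mathrm{sgn}_\alpha(j)$.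 Representation spaces. $\mathrm{Rep}(A,\alpha)$ is the affine scheme whose coordinate ring is generated by $a_{ij}$ ($a\in A$, $1\le i,j\le N$), linear in $a$, with $(ab)_{ij}=\sum_ra_{ir}b_{rj}$ and $(e_s)_{ij}=\delta_{ij}$ if $i,j\in\mathtt{R}_s$, $0$ otherwise; $\mathtt{X}(a)=(a_{ij})$. $\mathbb{C}[\mathrm{Rep}^{\phi,\tau}(A,\alpha)]$ is the quotient by the ideal generated by all $\phi(a)_{ij}-\mathrm{sgn}_\alpha(i,j)\,a_{\tau(j),\tau(i)}$. Notation $(c\otimes d)_{kj,il}=c_{kj}d_{il}$. $\mathrm{Sp}_\alpha$, embedded block-diagonally in $\mathrm{GL}_N$, acts by $g\cdot\mathtt{X}(a)=g^{-1}\mathtt{X}(a)g$ on coordinate functions, with infinitesimal action $\xi_M(\mathtt{X}(a))=[\mathtt{X}(a),\xi]$. Quasi-Poisson conventions. Let $G\subset\mathrm{GL}_N(\mathbb{C})$ be reductive with Lie algebra $\mathfrak g\subset\mathfrak{gl}_N$, trace form $\langle\xi,\eta\rangle=\mathrm{tr}(\xi\eta)$, basis $(F_a)$ of $\mathfrak g$ and dual basis $(\check F_a)$. Put $\psi^{\mathfrak g}=\frac1{12}\sum_{a,b,c}\langle\check F_a,[\check F_b,\check F_c]\rangle F_a\wedge F_b\wedge F_c$, with $x_1\wedge x_2\wedge x_3=\sum_{\sigma\in S_3}\mathrm{sgn}(\sigma)x_{\sigma(1)}\otimes x_{\sigma(2)}\otimes x_{\sigma(3)}$, and let $\psi^{\mathfrak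 g}_M$ be the trivector field obtained from the infinitesimal action $\xi\mapsto\xi_M$, where $\xi_M(f)(x)=\frac{d}{dt}|_{t=0}f(\exp(-t\xi)\cdot x)$. A $G$-invariant antisymmetric biderivation $\{-,-\}$ on $M$ is quasi-Poisson if $\{f,\{g,h\}\}+\{g,\{h,f\}\}+\{h,\{f,g\}\}=\frac12\psi^{\mathfrak g}_M(f,g,h)$. A moment map is a $G$-equivariant morphism $\Xi:M\to G$ (adjoint action on $G$) with $\{\Xi^*\mathcal{H},-\}=\frac12\sum_a\Xi^*((F_a^L+F_a^R)(\mathcal{H}))\,(\check F_a)_M$ for all functions $\mathcal{H}$ on $G$, where $\xi^L(\mathcal{H})(g)=\frac{d}{dt}|_{0}\mathcal{H}(ge^{t\xi})$, $\xi^R(\mathcal{H})(g)=\frac{d}{dt}|_0\mathcal{H}(e^{t\xi}g)$. *)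

(* Defs.v *)
From HB Require Import structures.
From mathcomp Require Import all_boot all_order all_algebra perm.
From mathcomp Require Import zify.
From mathcomp Require Import boolp reals complex.

Set Implicit Arguments.
Unset Strict Implicit.
Unset Printing Implicit Defensive.

Import GRing.Theory.
Local Open Scope ring_scope.
Local Open Scope quotient_scope.

Reserved Notation "v \ox w" (at level 40, left associativity).

(* A list of pairs stands for the sum of the corresponding pure tensors;    *)
(* [tensor V W] is the quotient by the bilinearity relations.               *)

Section Tensor.
Variables (K : comNzRingType) (V W : lmodType K).

Inductive tens_eq : seq (V * W) -> seq (V * W) -> Prop :=
| tens_refl s : tens_eq s s
| tens_sym s t : tens_eq s t -> tens_eq t s
| tens_trans s t u : tens_eq s t -> tens_eq t u -> tens_eq s u
| tens_cat s s' t t' : tens_eq s s' -> tens_eq t t' -> tens_eq (s ++ t) (s' ++ t')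
| tens_catC s t : tens_eq (s ++ t) (t ++ s)
| tens_addl v v' w : tens_eq [:: (v + v', w)] [:: (v, w); (v', w)]
| tens_addr v w w' : tens_eq [:: (v, w + w')] [:: (v, w); (v, w')]
| tens_scale c v w : tens_eq [:: (c *: v, w)] [:: (v, c *: w)]
| tens_zero w : tens_eq [:: (0, w)] [::].

Fact tens_equiv_axiom : equiv_class_of (fun s t => `[< tens_eq s t >]).
Proof.
split=> [s|s t|t s u].
- by apply/asboolP; exact: tens_refl.
- by apply/asbool_equiv_eq; split; exact: tens_sym.
- by move=> /asboolP st /asboolP tu; apply/asboolP; exact: tens_trans tu.
Qed.
Canonical tens_equiv := EquivRelPack tens_equiv_axiom.

Definition tensor : Type := {eq_quot tens_equiv}.
HB.instance Definition _ := Choice.on tensor.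

Definition tens_of (s : seq (V * W)) : tensor := \pi_({eq_quot tens_equiv}) s.
Definition tens_repr (t : tensor) : seq (V * W) :=
  repr (t : {eq_quot tens_equiv}).
Definition tens (v : V) (w : W) : tensor := tens_of [:: (v, w)].

Lemma tens_reprK : cancel tens_repr tens_of.
Proof. by move=> t; rewrite /tens_of /tens_repr reprK. Qed.

Lemma tens_ofP s t : tens_of s = tens_of t <-> tens_eq s t.
Proof. by split=> [/eqmodP/asboolP|st]; last exact/eqmodP/asboolP. Qed.

Lemma tens_repr_of s : tens_eq (tens_repr (tens_of s)) s.
Proof. by apply/tens_ofP; rewrite tens_reprK. Qed.

Definition tens_add (t u : tensor) := tens_of (tens_repr t ++ tens_repr u).
Definition tens_scal (c : K) (t : tensor) :=
  tens_of [seq (c *: p.1, p.2) | p <- tens_repr t].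

Lemma tens_scal_eq c s t : tens_eq s t ->
  tens_eq [seq (c *: p.1, p.2) | p <- s] [seq (c *: p.1, p.2) | p <- t].
Proof.
elim=> {s t}; try by [move=> *; rewrite ?map_cat; constructor].
- by move=> s t u _ st _ tu; exact: tens_trans st tu.
- by move=> v v' w /=; rewrite scalerDr; exact: tens_addl.
- move=> d v w /=; rewrite scalerA mulrC -scalerA; exact: tens_scale.
- by move=> w /=; rewrite scaler0; exact: tens_zero.
Qed.

Lemma tens_of_cat s t : tens_of (s ++ t) = tens_add (tens_of s) (tens_of t).
Proof. by apply/tens_ofP/tens_cat; exact/tens_sym/tens_repr_of. Qed.

Lemma tens_of_scal c s :
  tens_of [seq (c *: p.1, p.2) | p <- s] = tens_scal c (tens_of s).
Proof. by apply/tens_ofP/tens_scal_eq; exact/tens_sym/tens_repr_of. Qed.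

Lemma tens_of_ind (P : tensor -> Prop) : (forall s, P (tens_of s)) -> forall t, P t.
Proof. by move=> Ps t; rewrite -[t]tens_reprK. Qed.

Lemma tens_addA : associative tens_add.
Proof.
elim/tens_of_ind=> s; elim/tens_of_ind=> t; elim/tens_of_ind=> u.
by rewrite -!tens_of_cat catA.
Qed.

Lemma tens_addC : commutative tens_add.
Proof.
elim/tens_of_ind=> s; elim/tens_of_ind=> t.
by rewrite -!tens_of_cat; apply/tens_ofP/tens_catC.
Qed.

Lemma tens_add0 : left_id (tens_of [::]) tens_add.
Proof. by elim/tens_of_ind=> s; rewrite -tens_of_cat. Qed.

Lemma tens_of_cons v w s : tens_of ((v, w) :: s) = tens_add (tens v w) (tens_of s).
Proof. by rewrite -tens_of_cat. Qed.

Lemma tens_scalDl t : {morph tens_scal^~ t : c d / c + d >-> tens_add c d}.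
Proof.
move=> c d; elim/tens_of_ind: t => s; rewrite -!tens_of_scal.
elim: s => [|[v w] s IHs] /=; first by rewrite tens_add0.
rewrite !tens_of_cons {}IHs.
suff ->: tens ((c + d) *: v) w = tens_add (tens (c *: v) w) (tens (d *: v) w).
  rewrite -!tens_addA; congr tens_add; rewrite !tens_addA; congr tens_add.
  exact: tens_addC.
by rewrite -tens_of_cons; apply/tens_ofP; rewrite scalerDl; exact: tens_addl.
Qed.

Lemma tens_scalDr c : {morph tens_scal c : t u / tens_add t u}.
Proof.
elim/tens_of_ind=> s; elim/tens_of_ind=> t.
by rewrite -tens_of_cat -!tens_of_scal map_cat tens_of_cat.
Qed.

Lemma tens_scal0 t : tens_scal 0 t = tens_of [::].
Proof.
elim/tens_of_ind: t => s; rewrite -tens_of_scal.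
elim: s => [|[v w] s IHs] //=; rewrite tens_of_cons IHs scale0r.
by rewrite tens_addC tens_add0; apply/tens_ofP; exact: tens_zero.
Qed.

Lemma tens_scal1 : left_id 1 tens_scal.
Proof.
elim/tens_of_ind=> s; rewrite -tens_of_scal; congr tens_of.
by rewrite -[RHS]map_id; apply: eq_map => -[v w] /=; rewrite scale1r.
Qed.

Lemma tens_scalA c d t : tens_scal c (tens_scal d t) = tens_scal (c * d) t.
Proof.
elim/tens_of_ind: t => s; rewrite -!tens_of_scal -map_comp; congr tens_of.
by apply: eq_map => -[v w] /=; rewrite scalerA.
Qed.

Lemma tens_addN : left_inverse (tens_of [::]) (tens_scal (-1)) tens_add.
Proof.
by move=> t; rewrite -{2}[t]tens_scal1 -tens_scalDl addNr tens_scal0.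
Qed.

HB.instance Definition _ := GRing.isZmodule.Build tensor
  tens_addA tens_addC tens_add0 tens_addN.
HB.instance Definition _ := GRing.Zmodule_isLmodule.Build K tensor
  tens_scalA tens_scal1 tens_scalDr tens_scalDl.

(* The map induced by [f]; meaningful when [f] is bilinear (see [tliftE]).  *)
Definition tlift (U : nmodType) (f : V -> W -> U) (t : tensor) : U :=
  \sum_(p <- tens_repr t) f p.1 p.2.

Lemma tensDl v v' w : tens (v + v') w = tens v w + tens v' w.
Proof. by rewrite -[RHS]tens_of_cons; apply/tens_ofP; exact: tens_addl. Qed.

Lemma tensDr v w w' : tens v (w + w') = tens v w + tens v w'.
Proof. by rewrite -[RHS]tens_of_cons; apply/tens_ofP; exact: tens_addr. Qed.

Lemma tensZl c v w : tens (c *: v) w = c *: tens v w.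
Proof. by rewrite /tens (tens_of_scal c [:: (v, w)]). Qed.

Lemma tensZr c v w : tens v (c *: w) = c *: tens v w.
Proof. by rewrite -tensZl; apply/tens_ofP/tens_sym; exact: tens_scale. Qed.

Lemma tens_sum t : t = \sum_(p <- tens_repr t) tens p.1 p.2.
Proof.
rewrite -{1}[t]tens_reprK; elim: (tens_repr t) => [|[v w] s IHs].
  by rewrite big_nil.
by rewrite big_cons tens_of_cons IHs.
Qed.

Section Universal.
Variables (U : lmodType K) (f : V -> W -> U).
Hypothesis f_linl : forall w, linear (f^~ w).
Hypothesis f_linr : forall v, linear (f v).

Let fDl v v' w : f (v + v') w = f v w + f v' w.
Proof. by have := f_linl w 1 v v'; rewrite /= !scale1r. Qed.
Let fDr v w w' : f v (w + w') = f v w + f v w'.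
Proof. by have := f_linr v 1 w w'; rewrite /= !scale1r. Qed.
Let f0l w : f 0 w = 0.
Proof. by apply: (addrI (f 0 w)); rewrite -fDl !addr0. Qed.
Let f0r v : f v 0 = 0.
Proof. by apply: (addrI (f v 0)); rewrite -fDr !addr0. Qed.
Let fZl c v w : f (c *: v) w = c *: f v w.
Proof. by have := f_linl w c v 0; rewrite /= !addr0 f0l addr0. Qed.
Let fZr c v w : f v (c *: w) = c *: f v w.
Proof. by have := f_linr v c w 0; rewrite /= !addr0 f0r addr0. Qed.

Lemma tens_eq_sum s t : tens_eq s t ->
  \sum_(p <- s) f p.1 p.2 = \sum_(p <- t) f p.1 p.2.
Proof.
elim=> {s t} //.
- by move=> s t u _ -> _ ->.
- by move=> s s' t t' _ es _ et; rewrite !big_cat /= es et.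
- by move=> s t; rewrite !big_cat /= addrC.
- by move=> v v' w; rewrite !big_cons !big_nil /= !addr0 fDl.
- by move=> v w w'; rewrite !big_cons !big_nil /= !addr0 fDr.
- by move=> c v w; rewrite !big_cons !big_nil /= !addr0 fZl fZr.
- by move=> w; rewrite !big_cons !big_nil /= addr0 f0l.
Qed.

Lemma tlift_of s : tlift f (tens_of s) = \sum_(p <- s) f p.1 p.2.
Proof. exact/tens_eq_sum/tens_repr_of. Qed.

Lemma tliftE v w : tlift f (tens v w) = f v w.
Proof. by rewrite tlift_of big_seq1. Qed.

Lemma tlift_is_linear : linear (tlift f).
Proof.
move=> c; elim/tens_of_ind=> s; elim/tens_of_ind=> t.
have ->: c *: tens_of s + tens_of t =
         tens_of ([seq (c *: p.1, p.2) | p <- s] ++ t).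
  by rewrite tens_of_cat tens_of_scal.
rewrite !tlift_of big_cat /= big_map scaler_sumr; congr (_ + _).
by apply: eq_bigr => p _; rewrite /= fZl.
Qed.

End Universal.

End Tensor.

Notation "v \ox w" := (tens v w) : ring_scope.

(* [palg rel] is the commutative K-algebra generated by [G] subject to      *)
(* [rel]. It may be the zero ring, so it is a [comPzRingType], which is     *)
(* also an [lmodType K].                                                    *)

Section Presentation.
Variables (K : comNzRingType) (G : choiceType).

Inductive pterm : Type :=
| PGen of G
| PConst of K
| PAdd of pterm & pterm
| PMul of pterm & pterm.

HB.instance Definition _ := gen_eqMixin pterm.
HB.instance Definition _ := gen_choiceMixin pterm.

Definition psum (I : Type) (r : seq I) (F : I -> pterm) : pterm :=
  foldr (fun i t => PAdd (F i) t) (PConst 0) r.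

Fixpoint peval (B : comPzRingType) (c : K -> B) (v : G -> B) (t : pterm) : B :=
  match t with
  | PGen g => v g
  | PConst k => c k
  | PAdd s t => peval c v s + peval c v t
  | PMul s t => peval c v s * peval c v t
  end.

Fixpoint pder (B : comPzRingType) (ev : pterm -> B) (d : G -> B) (t : pterm) : B :=
  match t with
  | PGen g => d g
  | PConst _ => 0
  | PAdd s t => pder ev d s + pder ev d t
  | PMul s t => pder ev d s * ev t + ev s * pder ev d t
  end.

Variable rel : pterm -> pterm -> Prop.

Inductive pcong : pterm -> pterm -> Prop :=
| pcong_rel s t : rel s t -> pcong s t
| pcong_refl s : pcong s s
| pcong_sym s t : pcong s t -> pcong t s
| pcong_trans s t u : pcong s t -> pcong t u -> pcong s u
| pcong_add s s' t t' : pcong s s' -> pcong t t' -> pcong (PAdd s t) (PAdd s' t')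
| pcong_mul s s' t t' : pcong s s' -> pcong t t' -> pcong (PMul s t) (PMul s' t')
| pcong_addA s t u : pcong (PAdd s (PAdd t u)) (PAdd (PAdd s t) u)
| pcong_addC s t : pcong (PAdd s t) (PAdd t s)
| pcong_add0 s : pcong (PAdd (PConst 0) s) s
| pcong_addN s : pcong (PAdd (PMul (PConst (-1)) s) s) (PConst 0)
| pcong_mulA s t u : pcong (PMul s (PMul t u)) (PMul (PMul s t) u)
| pcong_mulC s t : pcong (PMul s t) (PMul t s)
| pcong_mul1 s : pcong (PMul (PConst 1) s) s
| pcong_mulDl s t u : pcong (PMul (PAdd s t) u) (PAdd (PMul s u) (PMul t u))
| pcong_constD c d : pcong (PConst (c + d)) (PAdd (PConst c) (PConst d))
| pcong_constM c d : pcong (PConst (c * d)) (PMul (PConst c) (PConst d)).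

Fact pcong_equiv_axiom : equiv_class_of (fun s t => `[< pcong s t >]).
Proof.
split=> [s|s t|t s u].
- by apply/asboolP; exact: pcong_refl.
- by apply/asbool_equiv_eq; split; exact: pcong_sym.
- by move=> /asboolP st /asboolP tu; apply/asboolP; exact: pcong_trans tu.
Qed.
Canonical pcong_equiv := EquivRelPack pcong_equiv_axiom.

Definition palg : Type := {eq_quot pcong_equiv}.
HB.instance Definition _ := Choice.on palg.

Definition palg_of (t : pterm) : palg := \pi_({eq_quot pcong_equiv}) t.
Definition palg_repr (x : palg) : pterm := repr (x : {eq_quot pcong_equiv}).

Lemma palg_reprK : cancel palg_repr palg_of.
Proof. by move=> x; rewrite /palg_of /palg_repr reprK. Qed.

Lemma palg_ofP s t : palg_of s = palg_of t <-> pcong s t.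
Proof. by split=> [/eqmodP/asboolP|st]; last exact/eqmodP/asboolP. Qed.

Lemma palg_repr_of s : pcong (palg_repr (palg_of s)) s.
Proof. by apply/palg_ofP; rewrite palg_reprK. Qed.

Lemma palg_of_ind (P : palg -> Prop) : (forall s, P (palg_of s)) -> forall x, P x.
Proof. by move=> Ps x; rewrite -[x]palg_reprK. Qed.

Definition palg_add (x y : palg) := palg_of (PAdd (palg_repr x) (palg_repr y)).
Definition palg_mul (x y : palg) := palg_of (PMul (palg_repr x) (palg_repr y)).
Definition palg_opp (x : palg) := palg_mul (palg_of (PConst (-1))) x.
Definition palg_scale (c : K) (x : palg) := palg_mul (palg_of (PConst c)) x.

Lemma palg_of_add s t : palg_of (PAdd s t) = palg_add (palg_of s) (palg_of t).
Proof. by apply/palg_ofP/pcong_add; exact/pcong_sym/palg_repr_of. Qed.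

Lemma palg_of_mul s t : palg_of (PMul s t) = palg_mul (palg_of s) (palg_of t).
Proof. by apply/palg_ofP/pcong_mul; exact/pcong_sym/palg_repr_of. Qed.

Let E := (palg_of_add, palg_of_mul).

Lemma palg_addA : associative palg_add.
Proof.
elim/palg_of_ind=> s; elim/palg_of_ind=> t; elim/palg_of_ind=> u.
by rewrite -!E; exact/palg_ofP/pcong_addA.
Qed.

Lemma palg_addC : commutative palg_add.
Proof.
elim/palg_of_ind=> s; elim/palg_of_ind=> t.
by rewrite -!E; exact/palg_ofP/pcong_addC.
Qed.

Lemma palg_add0 : left_id (palg_of (PConst 0)) palg_add.
Proof. by elim/palg_of_ind=> s; rewrite -!E; exact/palg_ofP/pcong_add0. Qed.

Lemma palg_addN : left_inverse (palg_of (PConst 0)) palg_opp palg_add.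
Proof.
by elim/palg_of_ind=> s; rewrite /palg_opp -!E; exact/palg_ofP/pcong_addN.
Qed.

Lemma palg_mulA : associative palg_mul.
Proof.
elim/palg_of_ind=> s; elim/palg_of_ind=> t; elim/palg_of_ind=> u.
by rewrite -!E; exact/palg_ofP/pcong_mulA.
Qed.

Lemma palg_mulC : commutative palg_mul.
Proof.
elim/palg_of_ind=> s; elim/palg_of_ind=> t.
by rewrite -!E; exact/palg_ofP/pcong_mulC.
Qed.

Lemma palg_mul1 : left_id (palg_of (PConst 1)) palg_mul.
Proof. by elim/palg_of_ind=> s; rewrite -!E; exact/palg_ofP/pcong_mul1. Qed.

Lemma palg_mulDl : left_distributive palg_mul palg_add.
Proof.
elim/palg_of_ind=> s; elim/palg_of_ind=> t; elim/palg_of_ind=> u.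
by rewrite -!E; exact/palg_ofP/pcong_mulDl.
Qed.

HB.instance Definition _ := GRing.isZmodule.Build palg
  palg_addA palg_addC palg_add0 palg_addN.

Lemma palg_mulr1 : right_id (palg_of (PConst 1)) palg_mul.
Proof. by move=> x; rewrite palg_mulC palg_mul1. Qed.

Lemma palg_mulDr : right_distributive palg_mul palg_add.
Proof. by move=> x y z; rewrite ![palg_mul x _]palg_mulC palg_mulDl. Qed.

HB.instance Definition _ := GRing.Zmodule_isPzRing.Build palg
  palg_mulA palg_mul1 palg_mulr1 palg_mulDl palg_mulDr.
HB.instance Definition _ := GRing.PzRing_hasCommutativeMul.Build palg palg_mulC.

Lemma palg_scaleA c d x : palg_scale c (palg_scale d x) = palg_scale (c * d) x.
Proof.
rewrite /palg_scale palg_mulA; congr palg_mul.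
by rewrite -E; exact/palg_ofP/pcong_sym/pcong_constM.
Qed.

Lemma palg_scale1 : left_id 1 palg_scale.
Proof. exact: palg_mul1. Qed.

Lemma palg_scaleDr : right_distributive palg_scale +%R.
Proof. by move=> c x y; exact: palg_mulDr. Qed.

Lemma palg_scaleDl x : {morph palg_scale^~ x : c d / c + d}.
Proof.
move=> c d; rewrite /palg_scale -[RHS]palg_mulDl; congr palg_mul.
by rewrite -E; exact/palg_ofP/pcong_constD.
Qed.

HB.instance Definition _ := GRing.Zmodule_isLmodule.Build K palg
  palg_scaleA palg_scale1 palg_scaleDr palg_scaleDl.

Definition pgen (g : G) : palg := palg_of (PGen g).
Definition pconst (c : K) : palg := palg_of (PConst c).

(* The algebra morphism (resp. the derivation) with prescribed values on    *)
(* the generators; meaningful when these values respect [rel]               *)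
(* (see [plift_gen], [plift_is_morphism], [pderiv_gen], [pderiv_is_der]).   *)
Definition plift (B : comPzRingType) (c : K -> B) (v : G -> B) (x : palg) : B :=
  peval c v (palg_repr x).
Definition pderiv (d : G -> palg) (x : palg) : palg :=
  pder palg_of d (palg_repr x).

Fact pconst_is_zmod_morphism : zmod_morphism pconst.
Proof.
move=> c d; apply: (addIr (pconst d)); rewrite subrK.
by rewrite -[LHS]palg_of_add -[in RHS](subrK d c); apply/palg_ofP/pcong_sym/pcong_constD.
Qed.
Fact pconst_is_monoid_morphism : monoid_morphism pconst.
Proof.
by split=> // c d; rewrite -[RHS]palg_of_mul; exact/palg_ofP/pcong_constM.
Qed.
HB.instance Definition _ := GRing.isZmodMorphism.Build K palg pconst
  pconst_is_zmod_morphism.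
HB.instance Definition _ := GRing.isMonoidMorphism.Build K palg pconst
  pconst_is_monoid_morphism.

Lemma palg_scaleE (c : K) (x : palg) : c *: x = pconst c * x.
Proof. by []. Qed.

Lemma pgen_rel s t : rel s t -> palg_of s = palg_of t.
Proof. by move=> st; apply/palg_ofP/pcong_rel. Qed.

Section Lift.
Variables (B : comPzRingType) (c : {rmorphism K -> B}) (v : G -> B).
Hypothesis v_rel : forall s t, rel s t -> peval c v s = peval c v t.

Lemma peval_cong s t : pcong s t -> peval c v s = peval c v t.
Proof.
elim=> {s t} //=.
- by move=> s t u _ -> _ ->.
- by move=> s s' t t' _ -> _ ->.
- by move=> s s' t t' _ -> _ ->.
- by move=> s t u; rewrite addrA.
- by move=> s t; rewrite addrC.
- by move=> s; rewrite rmorph0 add0r.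
- by move=> s; rewrite rmorphN rmorph1 rmorph0 mulN1r addNr.
- by move=> s t u; rewrite mulrA.
- by move=> s t; rewrite mulrC.
- by move=> s; rewrite rmorph1 mul1r.
- by move=> s t u; rewrite mulrDl.
- by move=> a b; rewrite rmorphD.
- by move=> a b; rewrite rmorphM.
Qed.

Lemma plift_of t : plift c v (palg_of t) = peval c v t.
Proof. exact/peval_cong/palg_repr_of. Qed.

Lemma plift_gen g : plift c v (pgen g) = v g.
Proof. exact: plift_of. Qed.

Lemma plift_const k : plift c v (pconst k) = c k.
Proof. exact: plift_of. Qed.

Lemma plift_is_morphism :
  {morph plift c v : x y / x + y} /\ {morph plift c v : x y / x * y}.
Proof.
split; elim/palg_of_ind=> s; elim/palg_of_ind=> t.
  by rewrite -[_ + _]palg_of_add !plift_of.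
by rewrite -[_ * _]palg_of_mul !plift_of.
Qed.

End Lift.

Section Derivation.
Variable d : G -> palg.
Hypothesis d_rel : forall s t, rel s t -> pder palg_of d s = pder palg_of d t.

Let pM s t : palg_of (PMul s t) = palg_of s * palg_of t.
Proof. exact: palg_of_mul. Qed.
Let pD s t : palg_of (PAdd s t) = palg_of s + palg_of t.
Proof. exact: palg_of_add. Qed.

Lemma pder_cong s t : pcong s t -> pder palg_of d s = pder palg_of d t.
Proof.
elim=> {s t} //=.
- by move=> s t u _ -> _ ->.
- by move=> s s' t t' _ -> _ ->.
- move=> s s' t t' /palg_ofP es -> /palg_ofP et ->.
  by rewrite es et.
- by move=> s t u; rewrite addrA.
- by move=> s t; rewrite addrC.
- by move=> s; rewrite add0r.
- move=> s; rewrite mul0r add0r.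
  have <- : -1 *: pder palg_of d s = palg_of (PConst (-1)) * pder palg_of d s by [].
  by rewrite scaleN1r addNr.
- by move=> s t u; rewrite !pM !(mulrDl, mulrDr) !mulrA addrA.
- by move=> s t; rewrite addrC mulrC [X in _ + X]mulrC.
- move=> s; rewrite mul0r add0r.
  have <- : 1 *: pder palg_of d s = palg_of (PConst 1) * pder palg_of d s by [].
  by rewrite scale1r.
- by move=> s t u; rewrite !pD !(mulrDl, mulrDr) addrACA.
- by rewrite addr0.
- by move=> c k; rewrite mul0r mulr0 addr0.
Qed.

Lemma pderiv_of t : pderiv d (palg_of t) = pder palg_of d t.
Proof. exact/pder_cong/palg_repr_of. Qed.

Lemma pderiv_gen g : pderiv d (pgen g) = d g.
Proof. exact: pderiv_of. Qed.

Lemma pderiv_is_der :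
  linear (pderiv d) /\
  (forall x y, pderiv d (x * y) = pderiv d x * y + x * pderiv d y).
Proof.
split=> [c|]; elim/palg_of_ind=> s; elim/palg_of_ind=> t.
  have e : c *: palg_of s + palg_of t = palg_of (PAdd (PMul (PConst c) s) t).
    by rewrite pD pM.
  by rewrite e !pderiv_of /= mul0r add0r.
by rewrite -pM !pderiv_of.
Qed.

End Derivation.

End Presentation.

Arguments PGen {K G}.
Arguments PConst {K G}.


Definition finitely_generated (K : fieldType) (A : algType K) : Prop :=
  exists s : seq A, forall P : A -> Prop,
    (forall c : K, P c%:A) ->
    (forall a b, P a -> P b -> P (a + b)) ->
    (forall a b, P a -> P b -> P (a * b)) ->
    (forall a, a \in s -> P a) ->
    forall a, P a.

Definition complete_orthogonal_idempotents
    (K : fieldType) (A : algType K) (n : nat) (e : 'I_n -> A) : Prop :=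
  (forall s t, e s * e t = if s == t then e s else 0) /\ \sum_s e s = 1.

Section DoubleBracket.
Variables (K : fieldType) (A : algType K) (n : nat) (e : 'I_n -> A).

Definition in_A0 (x : A) : Prop := exists c : 'I_n -> K, x = \sum_s c s *: e s.

Definition tflip (d : tensor A A) : tensor A A :=
  tlift (fun d' d'' => d'' \ox d') d.
Definition touter (a : A) (d : tensor A A) (b : A) : tensor A A :=
  tlift (fun d' d'' => (a * d') \ox (d'' * b)) d.
Definition tinner (a : A) (d : tensor A A) (b : A) : tensor A A :=
  tlift (fun d' d'' => (d' * b) \ox (a * d'')) d.

Record is_double_bracket (db : A -> A -> tensor A A) : Prop := {
  db_linear_l : forall b, linear (db^~ b);
  db_linear_r : forall a, linear (db a);
  db_antisym : forall a b, db a b = - tflip (db b a);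
  db_leibniz_r : forall a b c,
    db a (b * c) = touter 1 (db a b) c + touter b (db a c) 1;
  db_leibniz_l : forall a b c,
    db (b * c) a = tinner 1 (db b a) c + tinner b (db c a) 1;
  db_A0 : forall x a, in_A0 x -> db x a = 0 /\ db a x = 0
}.

Definition ttensor : Type := tensor (tensor A A) A.

Definition tau123 (t : ttensor) : ttensor :=
  tlift (fun d a3 => tlift (fun a1 a2 => (a3 \ox a1) \ox a2 : ttensor) d) t.

Variable db : A -> A -> tensor A A.

Definition dbL (a : A) (d : tensor A A) : ttensor :=
  tlift (fun d' d'' => (db a d') \ox d'' : ttensor) d.

Definition triple_bracket (a b c : A) : ttensor :=
  dbL a (db b c) + tau123 (dbL b (db c a)) + tau123 (tau123 (dbL c (db a b))).

Definition is_double_quasi_poisson : Prop :=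
  is_double_bracket db /\
  forall a b c : A,
    triple_bracket a b c =
    4^-1 *: \sum_s
      (  (c * e s * a) \ox (e s * b) \ox e s
       - (c * e s * a) \ox e s \ox (b * e s)
       - (c * e s) \ox (a * e s * b) \ox e s
       + (c * e s) \ox (a * e s) \ox (b * e s)
       - (e s * a) \ox (e s * b) \ox (e s * c)
       + (e s * a) \ox e s \ox (b * e s * c)
       + e s \ox (a * e s * b) \ox (e s * c)
       - e s \ox (a * e s) \ox (b * e s * c) : ttensor).

Definition is_double_moment_map (Phi : A) : Prop :=
  (exists Psi, Phi * Psi = 1 /\ Psi * Phi = 1) /\
  exists Phis : 'I_n -> A,
    [/\ Phi = \sum_s Phis s,
        forall s, exists a, Phis s = e s * a * e s
      & forall s a,
          db (Phis s) a =
          2^-1 *: (  (a * e s) \ox Phis s - e s \ox (Phis s * a)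
                   + (a * Phis s) \ox e s - Phis s \ox (e s * a))].

Record compatible_anti_involution (phi : A -> A) : Prop := {
  phi_linear : linear phi;
  phi_one : phi 1 = 1;
  phi_anti : forall a b, phi (a * b) = phi b * phi a;
  phi_involutive : involutive phi;
  phi_idem : forall s, phi (e s) = e s;
  phi_db : forall a b,
    tlift (fun d' d'' => phi d' \ox phi d'') (db a b) = tflip (db (phi a) (phi b))
}.

End DoubleBracket.

(* Indices are 0-based, so the first half of the block s is given by        *)
(* [tagnat.sig2 k < alpha s / 2], where [tagnat.sig1 k] is the s with k in  *)
(* the block s and [tagnat.sig2 k] is the position of k in that block.      *)

Definition Omega_block (B : comPzRingType) (d : nat) : 'M[B]_d :=
  \matrix_(i, j) (if (j == i + d./2 :> nat)%N then 1
                  else if (i == j + d./2 :> nat)%N then -1 else 0).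

Section Symplectic.
Variables (n : nat) (alpha : 'I_n -> nat).
Local Notation N := (\sum_(s < n) alpha s)%N.

Definition Omega (B : comPzRingType) : 'M[B]_N := \mxdiag_s Omega_block B (alpha s).

Definition first_half (k : 'I_N) : bool :=
  (tagnat.sig2 k < (alpha (tagnat.sig1 k))./2)%N.

Definition sgn (B : comPzRingType) (k : 'I_N) : B := if first_half k then 1 else -1.
Definition sgn2 (B : comPzRingType) (i j : 'I_N) : B := sgn B i * sgn B j.

(* The default value of [insubd] is not used when the dimensions are even.  *)
Definition tau_idx (k : 'I_N) : 'I_N :=
  insubd k (if first_half k then (k + (alpha (tagnat.sig1 k))./2)%N
            else (k - (alpha (tagnat.sig1 k))./2)%N).

(* The B-points of the group Sp_alpha and of its Lie algebra.               *)
Definition in_Sp (B : comPzRingType) (g : 'M[B]_N) : Prop :=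
  exists2 gs : forall s, 'M[B]_(alpha s),
    forall s, (gs s)^T *m Omega_block B (alpha s) *m gs s = Omega_block B (alpha s)
    & g = \mxdiag_s gs s.

Definition in_sp (B : comPzRingType) (xi : 'M[B]_N) : Prop :=
  exists2 xis : forall s, 'M[B]_(alpha s),
    forall s, (xis s)^T *m Omega_block B (alpha s)
              + Omega_block B (alpha s) *m xis s = 0
    & xi = \mxdiag_s xis s.

End Symplectic.

Section SymplecticIndices.
Variables (n : nat) (alpha : 'I_n -> nat).
Local Notation N := (\sum_(s < n) alpha s)%N.
Hypothesis alpha_even : forall s, ~~ odd (alpha s).

Lemma first_half_Rank s (a : 'I_(alpha s)) :
  first_half (tagnat.Rank s a) = (a < (alpha s)./2)%N.
Proof. by rewrite /first_half tagnat.Rank2K /= tagnat.Rank1K. Qed.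

Lemma tau_idx_Rank s (a b : 'I_(alpha s)) :
  (b = (if a < (alpha s)./2 then a + (alpha s)./2 else a - (alpha s)./2) :> nat)%N ->
  tau_idx (tagnat.Rank s a) = tagnat.Rank s b.
Proof.
move=> eb; apply/val_inj; rewrite /tau_idx first_half_Rank tagnat.Rank1K val_insubd.
have -> : (if (a < (alpha s)./2)%N then (tagnat.Rank s a + (alpha s)./2)%N
          else (tagnat.Rank s a - (alpha s)./2)%N) = tagnat.Rank s b :> nat.
  rewrite !tagnat.RankEsum eb; case: ifP => ha; first by rewrite addnA.
  by rewrite addnBA // leqNgt ha.
by rewrite ltn_ord.
Qed.

Lemma tau_idx_exists s (a : 'I_(alpha s)) : exists b : 'I_(alpha s),
  (b = (if a < (alpha s)./2 then a + (alpha s)./2 else a - (alpha s)./2) :> nat)%N.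
Proof.
have lt_b : ((if a < (alpha s)./2 then a + (alpha s)./2 else a - (alpha s)./2) < alpha s)%N.
  have := ltn_ord a; have := odd_double_half (alpha s).
  by rewrite (negPf (alpha_even s)) add0n -addnn; case: ifP; lia.
by exists (Ordinal lt_b).
Qed.

Lemma OmegaE (B : comPzRingType) i k :
  Omega alpha B i k = if k == tau_idx i then sgn B i else 0.
Proof.
rewrite -[ i](tagnat.sig2K i) -[k](tagnat.sig2K k).
move: (tagnat.sig1 i) (tagnat.sig2 i) (tagnat.sig1 k) (tagnat.sig2 k) => s a t b.
have [a' ea'] := tau_idx_exists a.
rewrite (tau_idx_Rank ea').
have -> : Omega alpha B (tagnat.Rank s a) (tagnat.Rank t b) =
          submxblock (Omega alpha B) s t a b by rewrite [RHS]mxE.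
have -> : (tagnat.Rank t b == tagnat.Rank s a') = (t == s) && (b == a' :> nat).
  by rewrite -tagnat.eq_Rank.
rewrite /Omega /mxdiag mxblockK [t == s]eq_sym.
case: eqVneq => [est|_] /=; last by rewrite mxE.
case: t / est b => b; rewrite conform_mx_id mxE /sgn first_half_Rank ea'.
have /= := odd_double_half (alpha s); rewrite (negPf (alpha_even s)) add0n -addnn.
move: (ltn_ord a) (ltn_ord b); move: ((alpha s)./2) => h.
rewrite -?val_eqE /=; move: (nat_of_ord a) (nat_of_ord b) => x y; move: (alpha s) => m.
case: (ltnP x h) => hx ym xm hm.
  by case: eqP => // _; case: eqP => //; lia.
have -> : (y == x + h)%N = false by apply/eqP; lia.
by have -> : (x == y + h)%N = (y == x - h)%N by apply/eqP/eqP; lia.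
Qed.

(* The index form of the involution xi |-> Omega xi^T Omega^T. *)
Lemma symplectic_involutionE (B : comPzRingType) (xi : 'M[B]_N) i j :
  (Omega alpha B *m xi^T *m (Omega alpha B)^T) i j =
  sgn2 B i j * xi (tau_idx j) (tau_idx i).
Proof.
rewrite mxE (bigD1 (tau_idx j)) //= [X in _ + X]big1 ?addr0; last first.
  by move=> k /negPf kj; rewrite [X in _ * X]mxE OmegaE kj mulr0.
rewrite mxE [X in _ * X]mxE OmegaE eqxx (bigD1 (tau_idx i)) //=.
rewrite [X in _ + X]big1 ?addr0; last by move=> k /negPf ki; rewrite OmegaE ki mul0r.
by rewrite OmegaE eqxx mxE /sgn2 mulrAC.
Qed.

End SymplecticIndices.


Section QuasiPoisson.
Variables (K : fieldType) (G : choiceType).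
Variable rel : pterm K G -> pterm K G -> Prop.
Local Notation O := (palg rel).

Record antisym_biderivation (br : O -> O -> O) : Prop := {
  br_linear_l : forall h, linear (br^~ h);
  br_linear_r : forall f, linear (br f);
  br_antisym : forall f h, br f h = - br h f;
  br_leibniz_l : forall f h k, br (f * h) k = br f k * h + f * br h k;
  br_leibniz_r : forall f h k, br f (h * k) = br f h * k + h * br f k
}.

Variable N : nat.

Definition mx_comm (xi eta : 'M[K]_N) : 'M[K]_N := xi *m eta - eta *m xi.

(* [F] is a basis of the Lie algebra [g], and [F'] its dual basis for the   *)
(* trace form.                                                              *)
Definition dual_bases (g : 'M[K]_N -> Prop) (d : nat)
    (F F' : d.-tuple 'M[K]_N) : Prop :=
  [/\ free F,
      forall xi, g xi <-> xi \in <<F>>%VS,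
      forall a : 'I_d, g (tnth F' a)
    & forall a b : 'I_d, \tr (tnth F a *m tnth F' b) = (a == b)%:R].

(* The trivector field of the Cartan trivector, for the infinitesimal       *)
(* action [inf] and the given dual bases.                                   *)
Definition cartan_trivector (inf : 'M[K]_N -> O -> O) (d : nat)
    (F F' : d.-tuple 'M[K]_N) (f1 f2 f3 : O) : O :=
  12^-1 *: \sum_(a < d) \sum_(b < d) \sum_(c < d)
    \tr (tnth F' a *m mx_comm (tnth F' b) (tnth F' c)) *:
    \sum_(s : 'S_3) (-1) ^+ s *
      \prod_(k < 3) inf (tnth [tuple tnth F a; tnth F b; tnth F c] (s k))
                        (tnth [tuple f1; f2; f3] k).

(* [grp] and [lie] are a matrix group and its Lie algebra, [act] and [inf]  *)
(* their actions on functions.                                              *)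
Definition quasi_poisson (grp lie : 'M[K]_N -> Prop)
    (act inf : 'M[K]_N -> O -> O) (br : O -> O -> O) : Prop :=
  [/\ antisym_biderivation br,
      forall g f h, grp g -> act g (br f h) = br (act g f) (act g h)
    & forall (d : nat) (F F' : d.-tuple 'M[K]_N), dual_bases lie F F' ->
      forall f g h,
        br f (br g h) + br g (br h f) + br h (br f g) =
        2^-1 *: cartan_trivector inf F F' f g h].

End QuasiPoisson.


Section SpCoordinateRing.
Variables (K : fieldType) (n : nat) (alpha : 'I_n -> nat).
Local Notation N := (\sum_(s < n) alpha s)%N.

Local Notation x i j := (PGen (i, j)).

Inductive sp_rel : pterm K ('I_N * 'I_N)%type -> pterm K ('I_N * 'I_N)%type -> Prop :=
| sp_rel_block i j : tagnat.sig1 i != tagnat.sig1 j -> sp_rel (x i j) (PConst 0)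
| sp_rel_form i j :
    sp_rel (psum (enum 'I_N) (fun k => psum (enum 'I_N) (fun l =>
              PMul (PMul (x k i) (PConst (Omega alpha K k l))) (x l j))))
           (PConst (Omega alpha K i j)).

Definition sp_coord := palg sp_rel.

Definition sp_mx : 'M[sp_coord]_N := \matrix_(i, j) pgen sp_rel (i, j).
Definition sp_const (xi : 'M[K]_N) : 'M[sp_coord]_N := map_mx (pconst sp_rel) xi.

(* The derivatives at t = 0 of H(g e^(t xi)) and of H(e^(t xi) g).          *)
Definition left_field (xi : 'M[K]_N) : sp_coord -> sp_coord :=
  pderiv (fun p => (sp_mx *m sp_const xi) p.1 p.2).
Definition right_field (xi : 'M[K]_N) : sp_coord -> sp_coord :=
  pderiv (fun p => (sp_const xi *m sp_mx) p.1 p.2).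

(* (Ad_g H)(y) = H(g^-1 y g), so that the adjoint action on the group        *)
(* induces a left action on its functions, as for [rep_act].                *)
Definition sp_Ad (g : 'M[K]_N) : sp_coord -> sp_coord :=
  plift (pconst sp_rel)
    (fun p => (sp_const (invmx g) *m sp_mx *m sp_const g) p.1 p.2).

End SpCoordinateRing.


Section RepresentationScheme.
Variables (K : fieldType) (A : algType K) (n : nat) (e : 'I_n -> A).
Variables (phi : A -> A) (alpha : 'I_n -> nat).
Local Notation N := (\sum_(s < n) alpha s)%N.
Local Notation gens := (A * 'I_N * 'I_N)%type.

Local Notation x a i j := (PGen (a, i, j)).

Inductive rep_rel : pterm K gens -> pterm K gens -> Prop :=
| rep_rel_add a b i j : rep_rel (x (a + b) i j) (PAdd (x a i j) (x b i j))
| rep_rel_scale c a i j : rep_rel (x (c *: a) i j) (PMul (PConst c) (x a i j))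
| rep_rel_mul a b i j :
    rep_rel (x (a * b) i j) (psum (enum 'I_N) (fun r => PMul (x a i r) (x b r j)))
| rep_rel_idem s i j :
    rep_rel (x (e s) i j)
      (PConst (if (tagnat.sig1 i == s) && (tagnat.sig1 j == s)
               then (i == j)%:R else 0))
| rep_rel_phi a i j :
    rep_rel (x (phi a) i j)
      (PMul (PConst (sgn2 K i j)) (x a (tau_idx j) (tau_idx i))).

Definition rep_coord := palg rep_rel.

Definition X (a : A) : 'M[rep_coord]_N := \matrix_(i, j) pgen rep_rel (a, i, j).
Definition rep_const (xi : 'M[K]_N) : 'M[rep_coord]_N := map_mx (pconst rep_rel) xi.

(* The action on functions, (g . f)(x) = f(g^-1 . x); on coordinates it is  *)
(* conjugation X(a) |-> g^-1 X(a) g.                                        *)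
Definition rep_act (g : 'M[K]_N) : rep_coord -> rep_coord :=
  plift (pconst rep_rel)
    (fun p => (rep_const (invmx g) *m X p.1.1 *m rep_const g) p.1.2 p.2).

(* The derivation d/dt f(exp(-t xi) . x) at t = 0; on coordinates it is     *)
(* X(a) |-> [X(a), xi].                                                     *)
Definition rep_inf (xi : 'M[K]_N) : rep_coord -> rep_coord :=
  pderiv (fun p => (X p.1.1 *m rep_const xi - rep_const xi *m X p.1.1) p.1.2 p.2).

Definition tentry (d : tensor A A) (k j i l : 'I_N) : rep_coord :=
  tlift (fun d' d'' => X d' k j * X d'' i l) d.

Definition bracket_formula (db : A -> A -> tensor A A)
    (br : rep_coord -> rep_coord -> rep_coord) : Prop :=
  forall (a b : A) (i j k l : 'I_N),
    br (X a i j) (X b k l) =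
      2^-1 *: tentry (db a b) k j i l
      + (2^-1 * sgn2 K i j) *: tentry (db (phi a) b) k (tau_idx i) (tau_idx j) l.

Definition rep_quasi_poisson (br : rep_coord -> rep_coord -> rep_coord) : Prop :=
  quasi_poisson (@in_Sp n alpha K) (@in_sp n alpha K) rep_act rep_inf br.

(* The comorphism of a morphism from the representation scheme to Sp_alpha  *)
(* given by a matrix [M] of functions.                                      *)
Definition pullback (M : 'M[rep_coord]_N) : sp_coord K alpha -> rep_coord :=
  plift (pconst rep_rel) (fun p => M p.1 p.2).

Definition rep_moment_map (br : rep_coord -> rep_coord -> rep_coord)
    (M : 'M[rep_coord]_N) : Prop :=
  [/\ in_Sp M,
      forall (g : 'M[K]_N) (H : sp_coord K alpha), in_Sp g ->
        rep_act g (pullback M H) = pullback M (sp_Ad g H)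
    & forall (d : nat) (F F' : d.-tuple 'M[K]_N),
      dual_bases (@in_sp n alpha K) F F' ->
      forall (H : sp_coord K alpha) (f : rep_coord),
        br (pullback M H) f =
        2^-1 *: \sum_(a < d)
          pullback M (left_field (tnth F a) H + right_field (tnth F a) H)
          * rep_inf (tnth F' a) f].

End RepresentationScheme.

(* Main.v *)
(* Write {a_ij, b_kl}_0 = {{a, b}}_(kj,il) for Van den Bergh's pre-bracket on    *)
(* coordinates, and call (a, i, j)' = (phi a, tau j, tau i) the flip of an index. *)
(* The bracket of the theorem is half the sum of {g, h}_0 over the flips of g,    *)
(* weighted by the signs for which all these coordinates agree on the quotient.   *)
(* Compatibility of phi with the double bracket says that {g', h'}_0 = {g, h}_0   *)
(* up to these signs, so one may as well flip h; hence the Jacobiator at (g, h, k)  *)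
(* is a quarter of the sum of the Jacobiators of {-,-}_0 over the flips of g and h. *)
(* By the double quasi-Poisson identity the latter are multiples of               *)
(* tr (P_g [P_h, P_k]), P_g being the block-diagonal part of the gradient of the   *)
(* coordinate g along the conjugation action. On the other side the Cartan        *)
(* trivector is a multiple of tr (Q_g [Q_h, Q_k]), where Q is the orthogonal      *)
(* projection of the gradient onto sp, that is the average of P over the two      *)
(* flips. For the moment map, {X(Phi), h}_0 = (X(Phi) P_h + P_h X(Phi)) / 2, and  *)
(* the flipped term is obtained by differentiating phi(Phi) = Phi^-1.             *)

Require Import Defs.
From mathcomp Require Import all_boot all_order all_algebra perm.
From mathcomp Require Import ring zify.
From mathcomp Require Import boolp reals complex.

Set Implicit Arguments.
Unset Strict Implicit.
Unset Printing Implicit Defensive.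

Import GRing.Theory.
Local Open Scope ring_scope.

(** * Symplectic matrices *)

(** On the quotient every coordinate has two names: an index [g] and, up to the sign [sgn_gen g],
    the index [flip_gen g]. The pre-bracket [vdb_bracket] depends on the name, but flipping both of
    its arguments only produces signs ([vdb_bracket_flip]). Averaging over the flips of one argument
    therefore gives an antisymmetric function on pairs of generators that respects all relations
    ([sp_bracket_gen_rel]), and [gen_bracket] extends it to a biderivation.

    Both sides of the quasi-Poisson identity are derivations in each argument, so generators suffice
    ([triderivation_ext]). There the Jacobiator is an average over the flips of the first two
    arguments ([sp_jacobiatorE]). The eight terms of the double quasi-Poisson identity are the
    expansion of the trace of a product of three commutators cut down to diagonal blocks, so each
    averaged term is a quarter of [triple_trace] at the matrices P = [block_commutator]
    ([vdb_jacobiatorE]). The Cartan trivector is half of [triple_trace] at the projections of the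
    same gradients to the symplectic Lie algebra ([cartan_trivectorE], [gradient_gen]). Since
    [tau_mx] reverses products and maps P at [g] to a signed P at [flip_gen g], the eight terms of
    its trilinear expansion agree in pairs ([triple_trace_tau_sum]), and the two sides coincide.

    Invariance holds because the inverse of a symplectic [g] is [tau_mx g], so conjugation by [g]
    commutes with the averaging. For the moment map, the double moment map identity computes the
    pre-bracket with [X Phi] ([vdb_mx_moment]), and differentiating [phi Phi * Phi = 1] computes the
    flipped half. Their sum replaces the gradient by its symplectic projection
    ([sp_bracket_moment]), which is the contraction with dual bases in the definition of a moment
    map. *)

Lemma mul_mxdiag (B : pzRingType) (p : nat) (q : 'I_p -> nat)
    (C D : forall i, 'M[B]_(q i)) :
  (\mxdiag_i C i) *m (\mxdiag_i D i) = \mxdiag_i (C i *m D i).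
Proof.
rewrite [\mxdiag_i D i]/mxdiag mul_mxdiag_mxblock; apply: eq_mxblock => i j.
case: eqVneq => [ij|_]; last by rewrite mulmx0.
by case: j / ij; rewrite !conform_mx_id.
Qed.

Section SymplecticMatrices.
Variables (n : nat) (alpha : 'I_n -> nat).
Local Notation N := (\sum_(s < n) alpha s)%N.
Hypothesis alpha_even : forall s, ~~ odd (alpha s).

(** Even block sizes keep the shift by half a block inside the block, so the two halves are
    exchanged. *)
Lemma tau_idxK : involutive (@tau_idx n alpha).
Proof.
move=> k; rewrite -[k](tagnat.sig2K k).
move: (tagnat.sig1 k) (tagnat.sig2 k) => s a.
have [b eb] := tau_idx_exists alpha_even a.
rewrite (tau_idx_Rank eb) (@tau_idx_Rank _ _ _ _ a) //.
have := odd_double_half (alpha s); rewrite (negPf (alpha_even s)) add0n -addnn.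
by have := ltn_ord a; rewrite eb; case: ifP; case: ifP; lia.
Qed.

Lemma sig1_tau (k : 'I_N) : tagnat.sig1 (tau_idx k) = tagnat.sig1 k.
Proof.
rewrite -[k](tagnat.sig2K k).
move: (tagnat.sig1 k) (tagnat.sig2 k) => s a.
have [b eb] := tau_idx_exists alpha_even a.
by rewrite (tau_idx_Rank eb) !tagnat.Rank1K.
Qed.

Lemma sgn_tau (B : comPzRingType) (k : 'I_N) : sgn B (tau_idx k) = - sgn B k.
Proof.
rewrite -[k](tagnat.sig2K k).
move: (tagnat.sig1 k) (tagnat.sig2 k) => s a.
have [b eb] := tau_idx_exists alpha_even a.
rewrite (tau_idx_Rank eb) /sgn !first_half_Rank eb.
have := odd_double_half (alpha s); rewrite (negPf (alpha_even s)) add0n -addnn.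
have := ltn_ord a; case: (ltnP a (alpha s)./2) => ? ? ?; first by rewrite ifF //; lia.
by rewrite opprK ifT //; lia.
Qed.

Lemma sgn_sqr (B : comPzRingType) (k : 'I_N) : sgn B k * sgn B k = 1.
Proof. by rewrite /sgn; case: ifP; rewrite ?mulrNN mul1r. Qed.

Lemma rmorph_sgn (K B : comPzRingType) (f : {rmorphism K -> B}) (k : 'I_N) :
  f (sgn K k) = sgn B k.
Proof. by rewrite /sgn; case: ifP; rewrite ?rmorphN rmorph1. Qed.

Lemma sgn2_sqr (B : comPzRingType) (i j : 'I_N) : sgn2 B i j * sgn2 B i j = 1.
Proof. by rewrite mulrACA !sgn_sqr mul1r. Qed.

Lemma sgn2_tau (B : comPzRingType) (i j : 'I_N) :
  sgn2 B (tau_idx i) (tau_idx j) = sgn2 B i j.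
Proof. by rewrite /sgn2 !sgn_tau mulrNN. Qed.

Lemma sgn2C (B : comPzRingType) (i j : 'I_N) : sgn2 B i j = sgn2 B j i.
Proof. exact: mulrC. Qed.

Lemma rmorph_sgn2 (K B : comPzRingType) (f : {rmorphism K -> B}) (i j : 'I_N) :
  f (sgn2 K i j) = sgn2 B i j.
Proof. by rewrite rmorphM !rmorph_sgn. Qed.

Section Involution.
Variable B : comPzRingType.
Implicit Types M Q : 'M[B]_N.

Definition tau_mx M : 'M[B]_N :=
  \matrix_(i, j) (sgn2 B i j * M (tau_idx j) (tau_idx i)).

Lemma tau_mxE M : tau_mx M = Omega alpha B *m M^T *m (Omega alpha B)^T.
Proof. by apply/matrixP=> i j; rewrite symplectic_involutionE // mxE. Qed.

Lemma tau_mxM M Q : tau_mx (M *m Q) = tau_mx Q *m tau_mx M.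
Proof.
apply/matrixP=> i j; rewrite !mxE (reindex_inj (inv_inj tau_idxK)) /= mulr_sumr.
apply: eq_bigr => r _; rewrite !mxE.
have h := sgn_sqr B r; rewrite /sgn2.
transitivity (sgn B i * sgn B j * (sgn B r * sgn B r)
              * (M (tau_idx j) (tau_idx r) * Q (tau_idx r) (tau_idx i))).
  by rewrite h mulr1.
ring.
Qed.

Lemma tau_mxK : involutive tau_mx.
Proof.
by move=> M; apply/matrixP=> i j; rewrite !mxE !tau_idxK sgn2_tau mulrA
  [sgn2 B j i]sgn2C sgn2_sqr mul1r.
Qed.

Lemma tau_mxB M Q : tau_mx (M - Q) = tau_mx M - tau_mx Q.
Proof. by apply/matrixP=> i j; rewrite !mxE mulrDr mulrN. Qed.

Lemma mxtrace_tau M : \tr (tau_mx M) = \tr M.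
Proof.
rewrite /mxtrace (reindex_inj (inv_inj tau_idxK)) /=; apply: eq_bigr => i _.
by rewrite mxE tau_idxK sgn2_tau /sgn2 sgn_sqr mul1r.
Qed.

Lemma Omega_sqr : Omega alpha B *m Omega alpha B = - 1%:M.
Proof.
apply/matrixP=> i j; rewrite !mxE (bigD1 (tau_idx i)) //= [X in _ + X]big1 ?addr0; last first.
  by move=> k /negPf ki; rewrite OmegaE // ki mul0r.
rewrite !OmegaE // eqxx tau_idxK sgn_tau eq_sym.
by case: eqP; rewrite ?mulr0 ?oppr0 // mulrN sgn_sqr.
Qed.

Lemma Omega_tr : (Omega alpha B)^T = - Omega alpha B.
Proof.
apply/matrixP=> i j; rewrite [LHS]mxE [RHS]mxE !OmegaE //.
rewrite [i == _]eq_sym (can2_eq tau_idxK tau_idxK).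
case: eqP => [->|_]; rewrite ?eqxx ?sgn_tau ?opprK //.
by rewrite oppr0.
Qed.

Definition block_diagonal M :=
  forall i j, tagnat.sig1 i != tagnat.sig1 j -> M i j = 0.

Lemma mxdiag_block_diagonal (D : forall s, 'M[B]_(alpha s)) :
  block_diagonal (\mxdiag_s D s).
Proof.
move=> i j /negPf ij; rewrite /mxdiag mxE ij.
by rewrite mxE.
Qed.

Lemma block_diagonalE M :
  block_diagonal M -> M = \mxdiag_s submxblock M s s.
Proof.
move=> Md; rewrite -[LHS](submxblockK); apply: eq_mxblock => i j.
case: eqVneq => [ij|ij]; first by case: j / ij; rewrite conform_mx_id.
by apply/matrixP=> a b; rewrite !mxE Md // !tagnat.Rank1K.
Qed.

Lemma tau_mx_SpP M :
  tau_mx M *m M = 1%:M <-> M^T *m Omega alpha B *m M = Omega alpha B.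
Proof.
rewrite tau_mxE Omega_tr mulmxN mulNmx -!mulmxA.
split=> [/(congr1 (mulmx (Omega alpha B)))|->].
  by rewrite mulmxN mulmxA Omega_sqr mulNmx mul1mx opprK mulmx1.
by rewrite Omega_sqr opprK.
Qed.

Lemma tau_mx_spP M :
  tau_mx M = - M <-> M^T *m Omega alpha B + Omega alpha B *m M = 0.
Proof.
rewrite tau_mxE Omega_tr mulmxN -mulmxA; split.
  move/oppr_inj/(congr1 (mulmx (Omega alpha B))).
  by rewrite (mulmxA _ (Omega alpha B)) Omega_sqr mulNmx mul1mx => <-; rewrite addrN.
move/eqP; rewrite addr_eq0 => /eqP ->.
by rewrite mulmxN (mulmxA _ (Omega alpha B)) Omega_sqr !mulNmx mul1mx opprK.
Qed.

(** Trades the family of symplectic blocks for two matrix identities, which can be checked entrywise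
    and pass through ring morphisms. *)
Lemma in_SpP M : in_Sp M <-> block_diagonal M /\ tau_mx M *m M = 1%:M.
Proof.
split=> [[D hD ->]|[Md /tau_mx_SpP Ms]].
  split; first exact: mxdiag_block_diagonal.
  apply/tau_mx_SpP; rewrite tr_mxdiag !mul_mxdiag; exact: eq_mxdiag.
exists (fun s => submxblock M s s); last exact: block_diagonalE.
have := Ms; rewrite {1 2}(block_diagonalE Md) tr_mxdiag !mul_mxdiag.
by rewrite /Omega => /eq_mxdiagP.
Qed.

Lemma in_spP M : in_sp M <-> block_diagonal M /\ tau_mx M = - M.
Proof.
split=> [[D hD ->]|[Md /tau_mx_spP Ms]].
  split; first exact: mxdiag_block_diagonal.
  apply/tau_mx_spP; rewrite tr_mxdiag !mul_mxdiag -mxdiagD -(@mxdiag0 _ _ alpha).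
  exact: eq_mxdiag.
exists (fun s => submxblock M s s); last exact: block_diagonalE.
have := Ms; rewrite {1 2}(block_diagonalE Md) tr_mxdiag !mul_mxdiag -mxdiagD.
by rewrite -(@mxdiag0 _ _ alpha) => /eq_mxdiagP.
Qed.

End Involution.

Lemma map_tau_mx (K B : comPzRingType) (f : {rmorphism K -> B}) (M : 'M[K]_N) :
  tau_mx (map_mx f M) = map_mx f (tau_mx M).
Proof. by apply/matrixP=> i j; rewrite !mxE rmorphM rmorph_sgn2. Qed.

End SymplecticMatrices.

(** * Derivations of presented algebras *)

Section PresentedAlgebra.
Variables (K : comNzRingType) (G : choiceType).
Variable rel : pterm K G -> pterm K G -> Prop.
Local Notation O := (palg rel).

Lemma palg_ofD s t : palg_of rel (PAdd s t) = palg_of rel s + palg_of rel t.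
Proof. exact: palg_of_add. Qed.

Lemma palg_ofM s t : palg_of rel (PMul s t) = palg_of rel s * palg_of rel t.
Proof. exact: palg_of_mul. Qed.

Lemma pscalerAl (c : K) (x y : O) : c *: (x * y) = (c *: x) * y.
Proof. by rewrite !palg_scaleE mulrA. Qed.

Lemma pscalerAr (c : K) (x y : O) : c *: (x * y) = x * (c *: y).
Proof. by rewrite !palg_scaleE mulrCA. Qed.

Lemma palg_of_psum (I : Type) (r : seq I) (F : I -> pterm K G) :
  palg_of rel (psum r F) = \sum_(i <- r) palg_of rel (F i).
Proof.
elim: r => [|i r IHr]; first by rewrite big_nil; exact: (rmorph0 (pconst rel)).
by rewrite big_cons -IHr -palg_ofD.
Qed.

Lemma peval_psum (B : comPzRingType) (c : {rmorphism K -> B}) (v : G -> B)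
    (I : Type) (r : seq I) (F : I -> pterm K G) :
  peval c v (psum r F) = \sum_(i <- r) peval c v (F i).
Proof.
by elim: r => [|i r IHr] /=; rewrite ?big_nil ?rmorph0 // big_cons -IHr.
Qed.

Lemma pder_psum (d : G -> O) (I : Type) (r : seq I) (F : I -> pterm K G) :
  pder (palg_of rel) d (psum r F) = \sum_(i <- r) pder (palg_of rel) d (F i).
Proof. by elim: r => [|i r IHr] /=; rewrite ?big_nil // big_cons -IHr. Qed.

(* [B] need not be an algebra over [K], so that linearity over the constants *)
(* is expressed by their vanishing.                                          *)
Record derivation_along (B : comPzRingType) (th D : O -> B) : Prop := {
  der_add : forall x y, D (x + y) = D x + D y;
  der_const : forall c, D (pconst rel c) = 0;
  der_mul : forall x y, D (x * y) = D x * th y + th x * D y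
}.

Lemma derivation_ext (B : comPzRingType) (th D D' : O -> B) :
  derivation_along th D -> derivation_along th D' ->
  (forall g, D (pgen rel g) = D' (pgen rel g)) -> D =1 D'.
Proof.
move=> hD hD' DD'; elim/palg_of_ind; elim=> [g|c|s IHs t IHt|s IHs t IHt].
- exact: DD'.
- by rewrite -[palg_of rel _]/(pconst rel c) (der_const hD) (der_const hD').
- by rewrite palg_ofD (der_add hD) (der_add hD') IHs IHt.
- by rewrite palg_ofM (der_mul hD) (der_mul hD') IHs IHt.
Qed.

Lemma linear_derivation (D : O -> O) : linear D ->
  (forall x y, D (x * y) = D x * y + x * D y) -> derivation_along id D.
Proof.
move=> lin leib; have DD x y : D (x + y) = D x + D y.
  by have := lin 1 x y; rewrite !scale1r.
have D0 : D 0 = 0 by apply: (addrI (D 0)); rewrite -DD !addr0.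
split=> // c.
have D1 : D 1 = 0.
  by apply: (addrI (D 1)); rewrite addr0 -[in RHS](mulr1 1) leib mulr1 mul1r.
have -> : pconst rel c = c *: (1 : O) + (0 : O) by rewrite palg_scaleE mulr1 addr0.
by rewrite lin D1 D0 scaler0 addr0.
Qed.

Lemma derivation_linear (D : O -> O) : derivation_along id D -> linear D.
Proof.
move=> hD c x y; rewrite !palg_scaleE (der_add hD) (der_mul hD) (der_const hD).
by rewrite mul0r add0r.
Qed.

Lemma morphism_ext (B : pzRingType) (f f' : O -> B) :
  {morph f : x y / x + y} -> {morph f : x y / x * y} ->
  {morph f' : x y / x + y} -> {morph f' : x y / x * y} ->
  (forall c, f (pconst rel c) = f' (pconst rel c)) ->
  (forall g, f (pgen rel g) = f' (pgen rel g)) -> f =1 f'.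
Proof.
move=> fD fM f'D f'M fc fg; elim/palg_of_ind; elim=> [g|c|s IHs t IHt|s IHs t IHt].
- exact: fg.
- exact: fc.
- by rewrite palg_ofD fD f'D IHs IHt.
- by rewrite palg_ofM fM f'M IHs IHt.
Qed.

Lemma pderiv_derivation (d : G -> O) :
  (forall s t, rel s t -> pder (palg_of rel) d s = pder (palg_of rel) d t) ->
  derivation_along id (pderiv d).
Proof. by case/pderiv_is_der; exact: linear_derivation. Qed.

(* Extend in the second argument first, then in the first one. *)
Section Biderivation.
Variable b : G -> G -> O.
Hypothesis b_anti : forall g h, b g h = - b h g.
Hypothesis b_rel : forall g s t, rel s t ->
  pder (palg_of rel) (b g) s = pder (palg_of rel) (b g) t.

Definition gen_bracket (x y : O) : O := pderiv (fun g => pderiv (b g) y) x.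

Let b_der g : derivation_along id (pderiv (b g)).
Proof. exact/pderiv_derivation/b_rel. Qed.

(** For a fixed term in the first slot, the derivation property in [y] propagates through sums and
    products by induction on the term, before any passage to the quotient. *)
Let pder_der s :
  derivation_along id (fun y => pder (palg_of rel) (fun g => pderiv (b g) y) s).
Proof.
elim: s => [g|c|s IHs t IHt|s IHs t IHt] /=; first exact: b_der.
- by split=> *; rewrite ?mul0r ?mulr0 ?addr0.
- split=> [x y|c|x y].
  + by rewrite (der_add IHs) (der_add IHt) addrACA.
  + by rewrite (der_const IHs) (der_const IHt) addr0.
  + by rewrite (der_mul IHs) (der_mul IHt) /=; ring.
- split=> [x y|c|x y].
  + by rewrite (der_add IHs) (der_add IHt); ring.
  + by rewrite (der_const IHs) (der_const IHt) mul0r mulr0 addr0.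
  + by rewrite (der_mul IHs) (der_mul IHt) /=; ring.
Qed.

(** Antisymmetry transfers compatibility with the relations from the second argument to the first:
    evaluated at a generator [h], the derivation in the first slot is minus the one attached to
    [h]. *)
Let b_rel_l s t y : rel s t ->
  pder (palg_of rel) (fun g => pderiv (b g) y) s =
  pder (palg_of rel) (fun g => pderiv (b g) y) t.
Proof.
move=> st; apply: (derivation_ext (pder_der s) (pder_der t)) => h.
have E u : pder (palg_of rel) (fun g => pderiv (b g) (pgen rel h)) u =
           - pder (palg_of rel) (b h) u.
  elim: u => [g|c|u IHu v IHv|u IHu v IHv] /=.
  - by rewrite pderiv_gen; [exact: b_anti|exact: b_rel].
  - by rewrite oppr0.
  - by rewrite IHu IHv; ring.
  - by rewrite IHu IHv; ring.
by rewrite !E (b_rel h st).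
Qed.

Lemma gen_bracket_gen g h : gen_bracket (pgen rel g) (pgen rel h) = b g h.
Proof.
rewrite /gen_bracket pderiv_gen ?pderiv_gen //; first exact: b_rel.
by move=> s t; exact: b_rel_l.
Qed.

Lemma gen_bracket_derl y : derivation_along id (gen_bracket^~ y).
Proof. by apply: pderiv_derivation => s t; exact: b_rel_l. Qed.

Lemma gen_bracket_derr x : derivation_along id (gen_bracket x).
Proof.
elim/palg_of_ind: x => s; have E y : gen_bracket (palg_of rel s) y =
    pder (palg_of rel) (fun g => pderiv (b g) y) s.
  by apply: pderiv_of => u v; exact: b_rel_l.
by split=> *; rewrite !E; case: (pder_der s).
Qed.

Lemma gen_bracket_anti x y : gen_bracket x y = - gen_bracket y x.
Proof.
move: x; apply: (derivation_ext (gen_bracket_derl y)).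
  have := gen_bracket_derr y; case=> hD hc hM; split=> *.
  - by rewrite hD opprD.
  - by rewrite hc oppr0.
  - by rewrite hM /=; ring.
move=> g; move: y; apply: (derivation_ext (gen_bracket_derr _)).
  have := gen_bracket_derl (pgen rel g); case=> hD hc hM; split=> *.
  - by rewrite hD opprD.
  - by rewrite hc oppr0.
  - by rewrite hM /=; ring.
by move=> h; rewrite !gen_bracket_gen.
Qed.

End Biderivation.

End PresentedAlgebra.

(** * Multiderivations are determined by their values on generators *)

Section Biderivations.
Variables (K : fieldType) (G : choiceType).
Variable rel : pterm K G -> pterm K G -> Prop.
Local Notation O := (palg rel).

Lemma gen_bracket_biderivation (b : G -> G -> O) :
  (forall g h, b g h = - b h g) ->
  (forall g s t, rel s t ->
     pder (palg_of rel) (b g) s = pder (palg_of rel) (b g) t) ->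
  antisym_biderivation (gen_bracket b).
Proof.
move=> b_anti b_rel; split.
- by move=> h; apply/derivation_linear/gen_bracket_derl.
- by move=> f; apply/derivation_linear/gen_bracket_derr.
- by move=> f h; apply: gen_bracket_anti.
- by move=> f h k; rewrite (der_mul (gen_bracket_derl b_anti b_rel k)).
- by move=> f h k; rewrite (der_mul (gen_bracket_derr b_anti b_rel f)).
Qed.

Section Bracket.
Variable br : O -> O -> O.
Hypothesis br_bider : antisym_biderivation br.

Lemma biderivation_derl y : derivation_along id (br^~ y).
Proof.
apply: linear_derivation; first exact: br_linear_l.
by move=> f h; rewrite (br_leibniz_l br_bider).
Qed.

Lemma biderivation_derr x : derivation_along id (br x).
Proof.
apply: linear_derivation; first exact: br_linear_r.
by move=> f h; rewrite (br_leibniz_r br_bider).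
Qed.

Definition jacobiator (f g h : O) := br f (br g h) + br g (br h f) + br h (br f g).

Lemma jacobiatorC f g h : jacobiator f g h = jacobiator g h f.
Proof. by rewrite /jacobiator -addrA addrC. Qed.

(** The products of two brackets created by the Leibniz rule, such as [{f, x} {g, y}], cancel by
    antisymmetry. The other two arguments follow from the cyclic symmetry [jacobiatorC]. *)
Lemma jacobiator_der f g : derivation_along id (jacobiator f g).
Proof.
have dr := biderivation_derr; have dl := biderivation_derl.
have anti := br_antisym br_bider.
split=> [x y|c|x y]; rewrite /jacobiator.
- rewrite (der_add (dr g)) (der_add (dl f)) (der_add (dr f)) (der_add (dr g)).
  by rewrite (der_add (dl _)); ring.
- rewrite (der_const (dr g)) (der_const (dl f)) (der_const (dl _)).
  have dr0 z : br z 0 = 0.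
    by have := der_const (dr z) 0; rewrite rmorph0.
  by rewrite !dr0 !addr0.
- rewrite (der_mul (dr g)) (der_mul (dl f)) (der_mul (dl _)) /=.
  rewrite (der_add (dr f)) (der_add (dr g)) !(der_mul (dr f)) !(der_mul (dr g)) /=.
  by rewrite (anti f x) (anti f y); ring.
Qed.

End Bracket.

Lemma biderivation_ext (br br' : O -> O -> O) :
  antisym_biderivation br -> antisym_biderivation br' ->
  (forall g h, br (pgen rel g) (pgen rel h) = br' (pgen rel g) (pgen rel h)) ->
  br =2 br'.
Proof.
move=> hbr hbr' e x y; move: x.
apply: (derivation_ext (biderivation_derl hbr y) (biderivation_derl hbr' y)) => g.
move: y; apply: (derivation_ext (biderivation_derr hbr _) (biderivation_derr hbr' _)).
exact: e.
Qed.

Lemma triderivation_ext (T T' : O -> O -> O -> O) :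
  (forall f g, derivation_along id (T f g)) ->
  (forall f h, derivation_along id (fun g => T f g h)) ->
  (forall g h, derivation_along id (fun f => T f g h)) ->
  (forall f g, derivation_along id (T' f g)) ->
  (forall f h, derivation_along id (fun g => T' f g h)) ->
  (forall g h, derivation_along id (fun f => T' f g h)) ->
  (forall a b c, T (pgen rel a) (pgen rel b) (pgen rel c) =
                 T' (pgen rel a) (pgen rel b) (pgen rel c)) ->
  forall f g h, T f g h = T' f g h.
Proof.
move=> T3 T2 T1 T3' T2' T1' e f g h; move: f.
apply: (derivation_ext (T1 g h) (T1' g h)) => a.
move: g; apply: (derivation_ext (T2 _ h) (T2' _ h)) => b.
move: h; apply: (derivation_ext (T3 _ _) (T3' _ _)) => c; exact: e.
Qed.

End Biderivations.

(** * Coordinate rings of representation spaces *)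

Section LinearMaps.
Variable K : comNzRingType.
Implicit Types U V W : lmodType K.

Lemma linear_add U V (f : U -> V) : linear f -> forall x y, f (x + y) = f x + f y.
Proof. by move=> lf x y; have := lf 1 x y; rewrite !scale1r. Qed.

Lemma linear_zero U V (f : U -> V) : linear f -> f 0 = 0.
Proof. by move=> lf; apply: (addrI (f 0)); rewrite -linear_add // !addr0. Qed.

Lemma linear_scale U V (f : U -> V) : linear f -> forall c x, f (c *: x) = c *: f x.
Proof.
by move=> lf c x; have := lf c x 0; rewrite addr0 (linear_zero lf) addr0.
Qed.

Lemma linear_opp U V (f : U -> V) : linear f -> forall x, f (- x) = - f x.
Proof. by move=> lf x; rewrite -scaleN1r linear_scale // scaleN1r. Qed.

Lemma linear_big U V (f : U -> V) : linear f ->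
  forall (I : Type) (r : seq I) (F : I -> U),
    f (\sum_(i <- r) F i) = \sum_(i <- r) f (F i).
Proof.
move=> lf I r F; elim: r => [|i r IHr]; first by rewrite !big_nil linear_zero.
by rewrite !big_cons linear_add // IHr.
Qed.

Lemma linear_comp U V W (f : V -> W) (g : U -> V) :
  linear f -> linear g -> linear (f \o g).
Proof. by move=> lf lg c x y /=; rewrite lg lf. Qed.

Lemma linear_addf U V (f g : U -> V) :
  linear f -> linear g -> linear (fun x => f x + g x).
Proof. by move=> lf lg c x y; rewrite lf lg scalerDr addrACA. Qed.

Lemma tensor_ext V W U (f f' : tensor V W -> U) : linear f -> linear f' ->
  (forall v w, f (v \ox w) = f' (v \ox w)) -> f =1 f'.
Proof.
move=> lf lf' ff' d; rewrite [d]tens_sum !linear_big //.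
exact: eq_bigr.
Qed.

End LinearMaps.

Section Idempotents.
Variables (n : nat) (alpha : 'I_n -> nat) (B : comPzRingType).
Local Notation N := (\sum_(s < n) alpha s)%N.

Definition idem_mx (s : 'I_n) : 'M[B]_N :=
  \matrix_(i, j) (if (tagnat.sig1 i == s) && (tagnat.sig1 j == s)
                  then (i == j)%:R else 0).

Lemma mul_idem_mxE m s (M : 'M[B]_(N, m)) i j :
  (idem_mx s *m M) i j = if tagnat.sig1 i == s then M i j else 0.
Proof.
rewrite mxE (bigD1 i) //= [X in _ + X]big1 ?addr0.
  by rewrite mxE eqxx andbb; case: ifP; rewrite ?mul1r ?mul0r.
by move=> r ri; rewrite mxE [i == r]eq_sym (negPf ri) if_same mul0r.
Qed.

Lemma mul_mx_idemE m s (M : 'M[B]_(m, N)) i j :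
  (M *m idem_mx s) i j = if tagnat.sig1 j == s then M i j else 0.
Proof.
rewrite mxE (bigD1 j) //= [X in _ + X]big1 ?addr0.
  by rewrite mxE eqxx andbb; case: ifP; rewrite ?mulr1 ?mulr0.
by move=> r rj; rewrite mxE (negPf rj) if_same mulr0.
Qed.

Lemma block_diagonal_comm s (M : 'M[B]_N) :
  block_diagonal M -> M *m idem_mx s = idem_mx s *m M.
Proof.
move=> Md; apply/matrixP=> i j; rewrite mul_idem_mxE mul_mx_idemE.
by case: (eqVneq (tagnat.sig1 i) (tagnat.sig1 j)) => [->|/Md ->] //; rewrite !if_same.
Qed.

End Idempotents.

Lemma block_diagonal_map (n : nat) (alpha : 'I_n -> nat) (K B : comPzRingType)
    (f : {rmorphism K -> B}) (M : 'M[K]_(\sum_(s < n) alpha s)) :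
  block_diagonal M -> block_diagonal (map_mx f M).
Proof. by move=> Md i j ij; rewrite mxE Md // rmorph0. Qed.

Section RepresentationAlgebra.
Variables (K : fieldType) (A : algType K) (n : nat) (e : 'I_n -> A).
Variables (phi : A -> A) (alpha : 'I_n -> nat).
Local Notation N := (\sum_(s < n) alpha s)%N.
Local Notation gens := (A * 'I_N * 'I_N)%type.
Local Notation O := (rep_coord e phi alpha).
Local Notation rel := (@rep_rel K A n e phi alpha).
Local Notation X := (X e phi alpha).
Local Notation sc := (pconst rel).
Hypothesis alpha_even : forall s, ~~ odd (alpha s).

Lemma XE a i j : X a i j = pgen rel (a, i, j).
Proof. by rewrite mxE. Qed.

Lemma XD a b : X (a + b) = X a + X b.
Proof.
apply/matrixP=> i j; rewrite !mxE [LHS](pgen_rel (rep_rel_add _ _ a b i j)).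
exact: palg_ofD.
Qed.

Lemma XZ c a : X (c *: a) = sc c *: X a.
Proof.
apply/matrixP=> i j; rewrite !mxE [LHS](pgen_rel (rep_rel_scale _ _ c a i j)).
exact: palg_ofM.
Qed.

Lemma XM a b : X (a * b) = X a *m X b.
Proof.
apply/matrixP=> i j; rewrite !mxE [LHS](pgen_rel (rep_rel_mul _ _ a b i j)).
rewrite palg_of_psum big_enum; apply: eq_bigr => r _.
by rewrite palg_ofM !mxE.
Qed.

Lemma X_idem s : X (e s) = idem_mx alpha O s.
Proof.
apply/matrixP=> i j; rewrite !mxE [LHS](pgen_rel (rep_rel_idem _ _ s i j)).
by rewrite -[LHS]/(sc _); case: ifP; rewrite ?rmorph0 ?rmorph_nat.
Qed.

Lemma X_phi a : X (phi a) = tau_mx (X a).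
Proof.
apply/matrixP=> i j; rewrite !mxE [LHS](pgen_rel (rep_rel_phi _ _ a i j)).
by rewrite palg_ofM -[palg_of _ (PConst _)]/(sc _) rmorph_sgn2.
Qed.

Lemma X_linear i j : linear (fun a => X a i j).
Proof. by move=> c a b; rewrite XD XZ !mxE. Qed.

Lemma X_one : complete_orthogonal_idempotents e -> X 1 = 1%:M.
Proof.
case=> _ <-; apply/matrixP=> i j.
rewrite (linear_big (X_linear i j)) (bigD1 (tagnat.sig1 i)) //= X_idem.
rewrite [X in _ + X]big1 ?addr0 => [|s si]; last first.
  by rewrite X_idem mxE [_ == s]eq_sym (negPf si).
by rewrite !mxE eqxx /=; case: (eqVneq i j) => [->|]; rewrite ?eqxx ?if_same.
Qed.

(** Criterion shared by the infinitesimal action and the bracket: the five hypotheses on a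
    matrix-valued map answer the five families of relations. *)
Lemma derivation_rep_rel (d : A -> 'M[O]_N) :
  (forall a b, d (a + b) = d a + d b) ->
  (forall c a, d (c *: a) = sc c *: d a) ->
  (forall a b, d (a * b) = d a *m X b + X a *m d b) ->
  (forall s, d (e s) = 0) ->
  (forall a, d (phi a) = tau_mx (d a)) ->
  forall s t, rel s t ->
    pder (palg_of rel) (fun p => d p.1.1 p.1.2 p.2) s =
    pder (palg_of rel) (fun p => d p.1.1 p.1.2 p.2) t.
Proof.
move=> dD dZ dM de dphi s t; case=> {s t} /=.
- by move=> a b i j; rewrite dD mxE.
- by move=> c a i j; rewrite dZ mxE mul0r add0r.
- move=> a b i j; rewrite dM pder_psum big_enum !mxE -big_split /=.
  by apply: eq_bigr => r _; rewrite !mxE.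
- by move=> s i j; rewrite de mxE.
- move=> a i j; rewrite dphi mxE mul0r add0r.
  by rewrite -[palg_of _ (PConst _)]/(sc _) rmorph_sgn2.
Qed.

Lemma morphism_rep_rel (B : comPzRingType) (c : {rmorphism K -> B}) (m : A -> 'M[B]_N) :
  (forall a b, m (a + b) = m a + m b) ->
  (forall k a, m (k *: a) = c k *: m a) ->
  (forall a b, m (a * b) = m a *m m b) ->
  (forall s, m (e s) = idem_mx alpha B s) ->
  (forall a, m (phi a) = tau_mx (m a)) ->
  forall s t, rel s t ->
    peval c (fun p => m p.1.1 p.1.2 p.2) s = peval c (fun p => m p.1.1 p.1.2 p.2) t.
Proof.
move=> mD mZ mM me mphi s t; case=> {s t} /=.
- by move=> a b i j; rewrite mD mxE.
- by move=> k a i j; rewrite mZ mxE.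
- move=> a b i j; rewrite mM peval_psum big_enum !mxE.
  by apply: eq_bigr => r _; rewrite ?mxE.
- by move=> s i j; rewrite me mxE; case: ifP; rewrite ?rmorph0 ?rmorph_nat.
- by move=> a i j; rewrite mphi mxE rmorph_sgn2.
Qed.

Section Infinitesimal.
Variable xi : 'M[K]_N.
Hypothesis xi_sp : in_sp xi.
Local Notation cxi := (map_mx sc xi).

Let xi_block : block_diagonal xi. Proof. by case/(in_spP alpha_even): xi_sp. Qed.
Let xi_tau : tau_mx xi = - xi. Proof. by case/(in_spP alpha_even): xi_sp. Qed.

Let inf_rel s t : rel s t ->
  pder (palg_of rel) (fun p => (X p.1.1 *m cxi - cxi *m X p.1.1) p.1.2 p.2) s =
  pder (palg_of rel) (fun p => (X p.1.1 *m cxi - cxi *m X p.1.1) p.1.2 p.2) t.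
Proof.
move: s t; apply: (@derivation_rep_rel (fun a => X a *m cxi - cxi *m X a)).
- by move=> a b; rewrite XD mulmxDl mulmxDr opprD addrACA.
- by move=> c a; rewrite XZ -scalemxAl -scalemxAr -scalerBr.
- move=> a b; rewrite XM mulmxBl mulmxBr !mulmxA.
  by rewrite [RHS]addrC addrA subrK.
- move=> s; rewrite X_idem block_diagonal_comm ?subrr //.
  exact: block_diagonal_map.
(* [tau_mx] reverses products and negates [xi], so it maps the commutator of [X a] with [xi] to that
   of [X (phi a)] with [xi]. *)
- move=> a; rewrite X_phi tau_mxB // !tau_mxM // map_tau_mx xi_tau.
  by rewrite map_mxN mulNmx mulmxN opprK addrC.
Qed.

Lemma rep_inf_X a i j :
  rep_inf xi (X a i j) = (X a *m cxi - cxi *m X a) i j.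
Proof. by rewrite XE /rep_inf pderiv_gen. Qed.

Lemma rep_inf_derivation : derivation_along id (rep_inf (e := e) (phi := phi) xi).
Proof. exact/pderiv_derivation/inf_rel. Qed.

End Infinitesimal.

Section Action.
Variable g : 'M[K]_N.
Hypothesis g_Sp : in_Sp g.
Local Notation cg := (map_mx sc g).
Local Notation cg' := (map_mx sc (invmx g)).

Let g_block : block_diagonal g. Proof. by case/(in_SpP alpha_even): g_Sp. Qed.
Let g_tau : tau_mx g *m g = 1%:M. Proof. by case/(in_SpP alpha_even): g_Sp. Qed.

Lemma Sp_unitmx : g \in unitmx.
Proof. by case: (mulmx1_unit g_tau). Qed.

Lemma Sp_invmx : invmx g = tau_mx g.
Proof. by rewrite -[invmx g]mul1mx -g_tau -mulmxA mulmxV ?mulmx1 ?Sp_unitmx. Qed.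

Lemma map_invmxM (B : comPzRingType) (f : {rmorphism K -> B}) :
  map_mx f g *m map_mx f (invmx g) = 1%:M.
Proof. by rewrite -map_mxM mulmxV ?Sp_unitmx // map_mx1. Qed.

Lemma map_mulVmx (B : comPzRingType) (f : {rmorphism K -> B}) :
  map_mx f (invmx g) *m map_mx f g = 1%:M.
Proof. by rewrite -map_mxM mulVmx ?Sp_unitmx // map_mx1. Qed.

Let act_rel s t : rel s t ->
  peval sc (fun p => (cg' *m X p.1.1 *m cg) p.1.2 p.2) s =
  peval sc (fun p => (cg' *m X p.1.1 *m cg) p.1.2 p.2) t.
Proof.
move: s t; apply: (@morphism_rep_rel _ _ (fun a => cg' *m X a *m cg)).
- by move=> a b; rewrite XD mulmxDr mulmxDl.
- by move=> c a; rewrite XZ -scalemxAr -scalemxAl.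
- by move=> a b; rewrite XM !mulmxA -[_ *m cg *m cg']mulmxA map_invmxM mulmx1.
- move=> s; rewrite X_idem -mulmxA -block_diagonal_comm ?mulmxA ?map_mulVmx ?mul1mx //.
  exact: block_diagonal_map.
- move=> a; rewrite !tau_mxM // !map_tau_mx -Sp_invmx X_phi mulmxA.
  have -> : tau_mx (invmx g) = g by rewrite Sp_invmx tau_mxK.
  by [].
Qed.

Lemma rep_act_X a i j : rep_act g (X a i j) = (cg' *m X a *m cg) i j.
Proof. by rewrite XE /rep_act plift_gen. Qed.

Lemma rep_act_const c : rep_act g (sc c) = sc c.
Proof. by rewrite /rep_act plift_const. Qed.

Lemma rep_actD : {morph rep_act (e := e) (phi := phi) g : x y / x + y}.
Proof. by case: (plift_is_morphism act_rel). Qed.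

Lemma rep_actM : {morph rep_act (e := e) (phi := phi) g : x y / x * y}.
Proof. by case: (plift_is_morphism act_rel). Qed.

End Action.

End RepresentationAlgebra.

(** * The bracket *)

Section Tensors.
Variables (K : fieldType) (A : algType K).
Implicit Types d : tensor A A.

Lemma tens_linear_l (V W : lmodType K) (w : W) : linear (fun v : V => v \ox w).
Proof. by move=> c u v; rewrite tensDl tensZl. Qed.

Lemma tens_linear_r (V W : lmodType K) (v : V) : linear (fun w : W => v \ox w).
Proof. by move=> c u w; rewrite tensDr tensZr. Qed.

Lemma tflip_linear : linear (@tflip K A).
Proof.
by apply: tlift_is_linear => [w|v]; [exact: tens_linear_r|exact: tens_linear_l].
Qed.

Lemma tflip_tens (a b : A) : tflip (a \ox b) = b \ox a.
Proof.
by apply: tliftE => [w|v]; [exact: tens_linear_r|exact: tens_linear_l].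
Qed.

Lemma tflipK : involutive (@tflip K A).
Proof.
apply: tensor_ext.
- exact: linear_comp tflip_linear tflip_linear.
- by [].
- by move=> a b; rewrite !tflip_tens.
Qed.

Lemma touter_linear (a b : A) : linear (fun d => touter a d b).
Proof.
apply: tlift_is_linear => [w|v] c x y /=.
  by rewrite mulrDr -scalerAr tensDl tensZl.
by rewrite mulrDl -scalerAl tensDr tensZr.
Qed.

Lemma touter_tens (a b x y : A) : touter a (x \ox y) b = (a * x) \ox (y * b).
Proof.
apply: tliftE => [w|v] c u u' /=.
  by rewrite mulrDr -scalerAr tensDl tensZl.
by rewrite mulrDl -scalerAl tensDr tensZr.
Qed.

End Tensors.

Section RepresentationBracket.
Variables (K : fieldType) (A : algType K) (n : nat) (e : 'I_n -> A).
Variables (db : A -> A -> tensor A A) (phi : A -> A) (alpha : 'I_n -> nat).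
Local Notation N := (\sum_(s < n) alpha s)%N.
Local Notation gens := (A * 'I_N * 'I_N)%type.
Local Notation O := (rep_coord e phi alpha).
Local Notation rel := (@rep_rel K A n e phi alpha).
Local Notation X := (X e phi alpha).
Local Notation sc := (pconst rel).
Local Notation tentry := (@tentry K A n e phi alpha).
Implicit Types (g h : gens) (d : tensor A A).
Hypothesis alpha_even : forall s, ~~ odd (alpha s).
Hypothesis db_double : is_double_bracket e db.
Hypothesis phi_compat : compatible_anti_involution e db phi.
Let tauK := tau_idxK alpha_even.
Let phiK := phi_involutive phi_compat.

Let mulXl i j (y : O) : linear (fun a => X a i j * y).
Proof. by move=> c a b; rewrite X_linear mulrDl -pscalerAl. Qed.

Let mulXr i j (y : O) : linear (fun a => y * X a i j).
Proof. by move=> c a b; rewrite ![y * _]mulrC mulXl. Qed.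

Lemma tentry_tens x y k j i l : tentry (x \ox y) k j i l = X x k j * X y i l.
Proof. exact: tliftE. Qed.

Lemma tentry_linear k j i l : linear (fun d => tentry d k j i l).
Proof. exact: tlift_is_linear. Qed.

Lemma tentry_tflip d k j i l : tentry (tflip d) k j i l = tentry d i l k j.
Proof.
move: d; apply: tensor_ext.
- exact: linear_comp (tentry_linear _ _ _ _) (@tflip_linear _ _).
- exact: tentry_linear.
- by move=> x y; rewrite tflip_tens !tentry_tens mulrC.
Qed.

Lemma tentry_touter_r d c k j i l :
  tentry (touter 1 d c) k j i l = \sum_r tentry d k j i r * X c r l.
Proof.
move: d; apply: tensor_ext.
- exact: linear_comp (tentry_linear _ _ _ _) (touter_linear _ _).
- move=> a u v; rewrite scaler_sumr -big_split; apply: eq_bigr => r _.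
  by rewrite tentry_linear mulrDl -pscalerAl.
- move=> x y; rewrite touter_tens tentry_tens mul1r XM [(_ *m _) _ _]mxE mulr_sumr.
  by apply: eq_bigr => r _; rewrite tentry_tens mulrA.
Qed.

Lemma tentry_touter_l d b k j i l :
  tentry (touter b d 1) k j i l = \sum_r X b k r * tentry d r j i l.
Proof.
move: d; apply: tensor_ext.
- exact: linear_comp (tentry_linear _ _ _ _) (touter_linear _ _).
- move=> a u v; rewrite scaler_sumr -big_split; apply: eq_bigr => r _.
  by rewrite tentry_linear mulrDr -pscalerAr.
- move=> x y; rewrite touter_tens tentry_tens mulr1 XM [(_ *m _) _ _]mxE mulr_suml.
  by apply: eq_bigr => r _; rewrite tentry_tens mulrA.
Qed.

(** The second name of a coordinate: on the quotient, the coordinate [g] equals [sgn_gen g] times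
    the coordinate [flip_gen g]. *)
Definition flip_gen g : gens := (phi g.1.1, tau_idx g.2, tau_idx g.1.2).
Definition sgn_gen g : O := sgn2 O g.1.2 g.2.

Lemma flip_genK : involutive flip_gen.
Proof. by case=> [[a i] j]; rewrite /flip_gen /= phiK !tauK. Qed.

Lemma sgn_gen_flip g : sgn_gen (flip_gen g) = sgn_gen g.
Proof. by rewrite /sgn_gen sgn2_tau // sgn2C. Qed.

Lemma sgn_gen_sqr g : sgn_gen g * sgn_gen g = 1.
Proof. exact: sgn2_sqr. Qed.

(* Van den Bergh's bracket [{a_ij, b_kl} = {{a, b}}_(kj,il)]; it does not descend *)
(* to the quotient by the relations of [phi].                                     *)
Definition vdb_bracket g h : O := tentry (db g.1.1 h.1.1) h.1.2 g.2 g.1.2 h.2.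

Lemma vdb_bracket_anti g h : vdb_bracket g h = - vdb_bracket h g.
Proof.
rewrite /vdb_bracket (db_antisym db_double).
by rewrite (linear_opp (tentry_linear _ _ _ _)) tentry_tflip.
Qed.

Lemma vdb_bracket_linear g k l : linear (fun b => vdb_bracket g (b, k, l)).
Proof.
exact: (linear_comp (tentry_linear _ _ _ _) (db_linear_r db_double _)).
Qed.

Lemma vdb_bracketM g b c k l : vdb_bracket g (b * c, k, l) =
  \sum_r vdb_bracket g (b, k, r) * X c r l + \sum_r X b k r * vdb_bracket g (c, r, l).
Proof.
rewrite /vdb_bracket /= (db_leibniz_r db_double) (linear_add (tentry_linear _ _ _ _)).
by rewrite tentry_touter_r tentry_touter_l.
Qed.

Lemma vdb_bracket_idem g s k l : vdb_bracket g (e s, k, l) = 0.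
Proof.
have [|_ E] := db_A0 db_double (x := e s) g.1.1.
  exists (fun t => (t == s)%:R).
  rewrite (bigD1 s) //= eqxx scale1r big1 ?addr0 // => t /negPf ->.
  by rewrite scale0r.
by rewrite /vdb_bracket /= E (linear_zero (tentry_linear _ _ _ _)).
Qed.

Let phi_tens := tlift (fun d' d'' : A => phi d' \ox phi d'').

Let phi_tens_bilinear :
  (forall w, linear (fun v => phi v \ox phi w)) *
  (forall v, linear (fun w => phi v \ox phi w)).
Proof.
by split=> [w|v] c x y; rewrite (phi_linear phi_compat) ?(tensDl, tensDr) ?(tensZl, tensZr).
Qed.

Let tentry_phi d k j i l : tentry (phi_tens d) k j i l =
  sgn2 O k j * sgn2 O i l * tentry d (tau_idx j) (tau_idx k) (tau_idx l) (tau_idx i).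
Proof.
move: d; apply: tensor_ext.
- apply: linear_comp (tentry_linear _ _ _ _) _.
  by apply: tlift_is_linear; case: phi_tens_bilinear.
- by move=> c x y; rewrite tentry_linear mulrDr -pscalerAr.
- move=> x y; rewrite /phi_tens tliftE; try by case: phi_tens_bilinear.
  by rewrite !tentry_tens !X_phi !mxE mulrACA.
Qed.

Lemma db_phi a b : db (phi a) (phi b) = tflip (phi_tens (db a b)).
Proof. by rewrite /phi_tens (phi_db phi_compat) tflipK. Qed.

(** Entrywise form of [phi_db]: the transposition in it matches the exchange of indices by
    [flip_gen], and [X_phi] supplies the signs. *)
Lemma vdb_bracket_flip g h :
  vdb_bracket (flip_gen g) (flip_gen h) = sgn_gen g * sgn_gen h * vdb_bracket g h.
Proof.
rewrite /vdb_bracket /flip_gen /= db_phi tentry_tflip tentry_phi !tauK /sgn_gen.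
by rewrite /sgn2 !sgn_tau //; ring.
Qed.

Lemma vdb_bracket_flipC g h :
  vdb_bracket g (flip_gen h) = sgn_gen g * sgn_gen h * vdb_bracket (flip_gen g) h.
Proof. by rewrite -{1}(flip_genK g) vdb_bracket_flip sgn_gen_flip. Qed.

Definition sp_bracket_gen g h : O :=
  sc 2^-1 * (vdb_bracket g h + sgn_gen g * vdb_bracket (flip_gen g) h).

(** The second summand is antisymmetric because its flip can be moved to the other argument by
    [vdb_bracket_flipC]. *)
Lemma sp_bracket_gen_anti g h : sp_bracket_gen g h = - sp_bracket_gen h g.
Proof.
rewrite /sp_bracket_gen (vdb_bracket_anti h g) (vdb_bracket_anti _ g).
rewrite vdb_bracket_flipC.
rewrite (_ : sgn_gen h * - _ =
  - (sgn_gen h * sgn_gen h * (sgn_gen g * vdb_bracket (flip_gen g) h))).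
  by rewrite sgn_gen_sqr; ring.
ring.
Qed.

(** Flipping [h] exchanges the two summands up to sign. This is the compatibility with the relations
    of [phi] that the pre-bracket lacks. *)
Lemma sp_bracket_gen_flip g h :
  sp_bracket_gen g (flip_gen h) = sgn_gen h * sp_bracket_gen g h.
Proof.
rewrite /sp_bracket_gen vdb_bracket_flipC vdb_bracket_flip.
rewrite (_ : sgn_gen g * (sgn_gen g * _ * _) =
             (sgn_gen g * sgn_gen g) * (sgn_gen h * vdb_bracket g h)); last by ring.
by rewrite sgn_gen_sqr; ring.
Qed.

Lemma sp_bracket_gen_rel g s t : rel s t ->
  pder (palg_of rel) (sp_bracket_gen g) s = pder (palg_of rel) (sp_bracket_gen g) t.
Proof.
pose d (b : A) : 'M[O]_N := \matrix_(k, l) sp_bracket_gen g (b, k, l).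
have -> : sp_bracket_gen g = (fun p => d p.1.1 p.1.2 p.2).
  by apply/funext=> -[[b k] l]; rewrite mxE.
have lin k l : linear (fun b => sp_bracket_gen g (b, k, l)).
  move=> c x y; rewrite /sp_bracket_gen !vdb_bracket_linear !palg_scaleE.
  ring.
move: s t; apply: derivation_rep_rel => //.
- by move=> a b; apply/matrixP=> k l; rewrite !mxE (linear_add (lin k l)).
- by move=> c a; apply/matrixP=> k l; rewrite !mxE (linear_scale (lin k l)).
- move=> a b; apply/matrixP=> k l; rewrite [LHS]mxE [RHS]mxE ![(_ *m _) _ _]mxE.
  rewrite /sp_bracket_gen !vdb_bracketM [sgn_gen g * _]mulrDr addrACA mulrDr.
  by congr (_ + _); rewrite mulr_sumr -big_split mulr_sumr; apply: eq_bigr => r _ /=;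
    rewrite [d _ _ _]mxE /sp_bracket_gen; ring.
- move=> s; apply/matrixP=> k l; rewrite !mxE /sp_bracket_gen !vdb_bracket_idem.
  by rewrite mulr0 addr0 mulr0.
- move=> a; apply/matrixP=> k l; rewrite !mxE.
  have -> : (phi a, k, l) = flip_gen (a, tau_idx l, tau_idx k).
    by rewrite /flip_gen /= !tauK.
  by rewrite sp_bracket_gen_flip /sgn_gen /= sgn2_tau // sgn2C.
Qed.

Definition sp_bracket : O -> O -> O := gen_bracket sp_bracket_gen.

Lemma sp_bracket_biderivation : antisym_biderivation sp_bracket.
Proof.
exact: gen_bracket_biderivation sp_bracket_gen_anti sp_bracket_gen_rel.
Qed.

Lemma sp_bracketE g h : sp_bracket (pgen rel g) (pgen rel h) = sp_bracket_gen g h.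
Proof. exact: gen_bracket_gen sp_bracket_gen_anti sp_bracket_gen_rel _ _. Qed.

Lemma sp_bracket_formula : bracket_formula db sp_bracket.
Proof.
move=> a b i j k l; rewrite !XE sp_bracketE /sp_bracket_gen.
rewrite !palg_scaleE rmorphM rmorph_sgn2 mulrDr mulrA.
by [].
Qed.

End RepresentationBracket.

(** * The Jacobiator *)

(** The invariant alternating form tr (x [y, z]) that underlies the Cartan trivector. *)
Definition triple_trace (B : pzRingType) (N : nat) (x y z : 'M[B]_N) : B :=
  \tr (x *m y *m z) - \tr (x *m z *m y).

Section TripleTrace.
Variables (n : nat) (alpha : 'I_n -> nat) (B : comPzRingType).
Local Notation N := (\sum_(s < n) alpha s)%N.
Hypothesis alpha_even : forall s, ~~ odd (alpha s).
Implicit Types x y z : 'M[B]_N.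

(** [tau_mx] preserves traces and reverses products, so it exchanges the two terms of
    [triple_trace]; the resulting sign compensates the three minus signs of the hypotheses. *)
Lemma triple_trace_tau x y z x' y' z' (a b c : B) :
  a * a = 1 -> b * b = 1 -> c * c = 1 ->
  tau_mx x = - a *: x' -> tau_mx y = - b *: y' -> tau_mx z = - c *: z' ->
  triple_trace x' y' z' = a * b * c * triple_trace x y z.
Proof.
move=> aa bb cc ex ey ez.
have C (u v w : 'M[B]_N) : \tr (u *m v *m w) = \tr (v *m w *m u).
  by rewrite -mulmxA mxtrace_mulC.
rewrite /triple_trace -(mxtrace_tau alpha_even (x *m y *m z)).
rewrite -(mxtrace_tau alpha_even (x *m z *m y)) !tau_mxM // ex ey ez !mulmxA.
rewrite -!(scalemxAl, scalemxAr) !mxtraceZ (C z' y' x') (C y' x' z') (C y' z' x').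
rewrite (C z' x' y').
transitivity ((a * a) * (b * b) * (c * c)
  * (\tr (x' *m y' *m z') - \tr (x' *m z' *m y'))); last by ring.
by rewrite aa bb cc !mul1r.
Qed.

Lemma triple_trace_sum x y z x' y' z' (t a b c : B) :
  triple_trace (t *: (x + a *: x')) (t *: (y + b *: y')) (t *: (z + c *: z')) =
  t * t * t *
    (triple_trace x y z + a * triple_trace x' y z + b * triple_trace x y' z
     + c * triple_trace x y z' + a * b * triple_trace x' y' z
     + a * c * triple_trace x' y z' + b * c * triple_trace x y' z'
     + a * b * c * triple_trace x' y' z').
Proof.
rewrite /triple_trace -!(scalemxAl, scalemxAr) !mxtraceZ.
rewrite !(mulmxDl, mulmxDr, scalerDr) -!(scalemxAl, scalemxAr) !raddfD /= !mxtraceZ.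
ring.
Qed.

(** Of the eight terms in the trilinear expansion, each one involving [z'] equals the term where all
    three arguments are exchanged with their partners; this removes [z'] and doubles the rest. *)
Lemma triple_trace_tau_sum x y z x' y' z' (t a b c : B) :
  a * a = 1 -> b * b = 1 -> c * c = 1 ->
  tau_mx x = - a *: x' -> tau_mx y = - b *: y' -> tau_mx z = - c *: z' ->
  tau_mx x' = - a *: x -> tau_mx y' = - b *: y ->
  triple_trace (t *: (x + a *: x')) (t *: (y + b *: y')) (t *: (z + c *: z')) =
  t * t * t * 2%:R *
    (triple_trace x y z + a * triple_trace x' y z + b * triple_trace x y' z
     + a * b * triple_trace x' y' z).
Proof.
move=> aa bb cc ex ey ez ex' ey'; rewrite triple_trace_sum.
rewrite (triple_trace_tau aa bb cc ex' ey' ez) (triple_trace_tau aa bb cc ex ey' ez).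
rewrite (triple_trace_tau aa bb cc ex' ey ez) (triple_trace_tau aa bb cc ex ey ez).
move: (triple_trace x y z) (triple_trace x' y z) => p q.
move: (triple_trace x y' z) (triple_trace x' y' z) => r s.
transitivity (t * t * t * (p + a * q + b * r + c * c * (a * b) * s
  + a * b * s + (a * a) * (c * c) * b * r + (b * b) * (c * c) * a * q
  + (a * a) * (b * b) * (c * c) * p)); first by ring.
by rewrite aa bb cc; ring.
Qed.

End TripleTrace.

(** * Diagonal blocks and traces of products of commutators *)

Section BlockPart.
Variables (n : nat) (alpha : 'I_n -> nat) (B : comPzRingType).
Local Notation N := (\sum_(s < n) alpha s)%N.
Local Notation E := (idem_mx alpha B).
Implicit Types M : 'M[B]_N.

Definition block_part M : 'M[B]_N :=
  \matrix_(i, j) (if tagnat.sig1 i == tagnat.sig1 j then M i j else 0).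

Lemma block_part_idem M s : block_part M *m E s = E s *m M *m E s.
Proof.
apply/matrixP=> i j; rewrite !mul_mx_idemE mul_idem_mxE mxE.
by case: eqP => // ->.
Qed.

Lemma idem_mxK s : E s *m E s = E s.
Proof.
apply/matrixP=> i j; rewrite mul_idem_mxE; case: ifP => // si.
by rewrite mxE si.
Qed.

Lemma mxtrace_idem M : \tr M = \sum_s \tr (M *m E s).
Proof.
rewrite exchange_big /=; apply: eq_bigr => i _.
rewrite [RHS](bigD1 (tagnat.sig1 i)) //= [X in _ + X]big1 ?addr0 => [|s si].
  by rewrite mul_mx_idemE eqxx.
by rewrite mul_mx_idemE eq_sym (negPf si).
Qed.

(** This is where the sum over the idempotents in the double quasi-Poisson identity comes from. *)
Lemma mxtrace_block_part3 M1 M2 M3 :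
  \tr (block_part M1 *m block_part M2 *m block_part M3) =
  \sum_s \tr (E s *m M1 *m E s *m M2 *m E s *m M3 *m E s).
Proof.
rewrite mxtrace_idem; apply: eq_bigr => s _; congr (\tr _).
rewrite -mulmxA block_part_idem -!mulmxA (mulmxA _ (E s)) block_part_idem.
by rewrite -!mulmxA (mulmxA _ (E s)) block_part_idem !mulmxA.
Qed.

Lemma mul_mx_delta (m p q r : nat) (Y : 'M[B]_(m, p)) (Z : 'M[B]_(q, r)) j i a b :
  (Y *m delta_mx j i *m Z) a b = Y a j * Z i b.
Proof.
rewrite mxE (bigD1 i) //= [X in _ + X]big1 ?addr0 => [|k ki]; last first.
  rewrite mxE big1 ?mul0r // => l _.
  by rewrite mxE (negPf ki) andbF mulr0.
rewrite mxE (bigD1 j) //= [X in _ + X]big1 ?addr0 => [|k kj]; last first.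
  by rewrite mxE (negPf kj) mulr0.
by rewrite mxE !eqxx mulr1.
Qed.

Lemma mxtrace_delta3 (Y1 Y2 Y3 Y4 : 'M[B]_N) j i l k v u :
  \tr (Y1 *m delta_mx j i *m Y2 *m delta_mx l k *m Y3 *m delta_mx v u *m Y4) =
  (Y4 *m Y1) u j * Y2 i l * Y3 k v.
Proof.
rewrite [X in X * _ * _]mxE !mulr_suml; apply: eq_bigr => p _.
by rewrite !mul_mx_delta; ring.
Qed.

(* The gradient of the coordinate [a_ij] along the conjugation action is    *)
(* [commutator_mx i j X(a)]: the field of [xi] maps [a_ij] to               *)
(* [tr (xi * commutator_mx i j X(a))].                                      *)
Definition commutator_mx i j M : 'M[B]_N := delta_mx j i *m M - M *m delta_mx j i.

(** With [F] the matrix of an idempotent [e s], the right-hand side lists, in the same order, the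
    entries of the eight tensors of the double quasi-Poisson identity. *)
Lemma mxtrace_commutator3 (M1 M2 M3 F : 'M[B]_N) i j k l u v : F *m F = F ->
  \tr (F *m commutator_mx i j M1 *m F *m commutator_mx k l M2 *m F
       *m commutator_mx u v M3 *m F) =
    (M3 *m F *m M1) u j * (F *m M2) i l * F k v
  - (M3 *m F *m M1) u j * F i l * (M2 *m F) k v
  - (M3 *m F) u j * (M1 *m F *m M2) i l * F k v
  + (M3 *m F) u j * (M1 *m F) i l * (M2 *m F) k v
  - (F *m M1) u j * (F *m M2) i l * (F *m M3) k v
  + (F *m M1) u j * F i l * (M2 *m F *m M3) k v
  + F u j * (M1 *m F *m M2) i l * (F *m M3) k v
  - F u j * (M1 *m F) i l * (M2 *m F *m M3) k v.
Proof.
move=> FF; have FFl M : M *m F *m F = M *m F by rewrite -mulmxA FF.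
have T Y1 Y2 Y3 Y4 := mxtrace_delta3 Y1 Y2 Y3 Y4 j i l k v u.
(* One instance for each choice of a term in the three commutators. *)
have T1 := T F (M1 *m F) (M2 *m F) (M3 *m F).
have T2 := T F (M1 *m F) (M2 *m F *m M3) F.
have T3 := T F (M1 *m F *m M2) F (M3 *m F).
have T4 := T F (M1 *m F *m M2) (F *m M3) F.
have T5 := T (F *m M1) F (M2 *m F) (M3 *m F).
have T6 := T (F *m M1) F (M2 *m F *m M3) F.
have T7 := T (F *m M1) (F *m M2) F (M3 *m F).
have T8 := T (F *m M1) (F *m M2) (F *m M3) F.
rewrite !(mulmxA, FF, FFl) in T1 T2 T3 T4 T5 T6 T7 T8.
rewrite /commutator_mx !(mulmxBl, mulmxBr, mulmxA) !raddfB /=.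
rewrite T1 T2 T3 T4 T5 T6 T7 T8; ring.
Qed.

Lemma tau_mx_block_part : (forall s, ~~ odd (alpha s)) ->
  forall M, tau_mx (block_part M) = block_part (tau_mx M).
Proof.
move=> ev M; apply/matrixP=> i j; rewrite !mxE !sig1_tau // eq_sym.
by case: ifP; rewrite ?mulr0.
Qed.

(** Reversal of products turns the commutator around, hence the minus sign, while the elementary
    matrix goes to a signed elementary matrix. *)
Lemma tau_mx_commutator : (forall s, ~~ odd (alpha s)) -> forall i j M,
  tau_mx (commutator_mx i j M) =
  - sgn2 B i j *: commutator_mx (tau_idx j) (tau_idx i) (tau_mx M).
Proof.
move=> ev i j M; have tauK := tau_idxK ev; rewrite tau_mxB // !tau_mxM //.
have -> : tau_mx (delta_mx j i) = sgn2 B i j *: delta_mx (tau_idx i) (tau_idx j) :> 'M[B]_N.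
  apply/matrixP=> p q; rewrite !mxE andbC.
  rewrite (can2_eq tauK tauK) [tau_idx q == _](can2_eq tauK tauK).
  case: eqP => [->|_]; case: eqP => [->|_]; rewrite ?mulr0 //.
  by rewrite sgn2_tau.
by rewrite -scalemxAl -scalemxAr -scalerBr scaleNr -scalerN opprB.
Qed.

End BlockPart.

(** * From the triple bracket to the Jacobiator on generators *)

Section Jacobiator.
Variables (K : fieldType) (A : algType K) (n : nat) (e : 'I_n -> A).
Variables (db : A -> A -> tensor A A) (phi : A -> A) (alpha : 'I_n -> nat).
Local Notation N := (\sum_(s < n) alpha s)%N.
Local Notation gens := (A * 'I_N * 'I_N)%type.
Local Notation O := (rep_coord e phi alpha).
Local Notation rel := (@rep_rel K A n e phi alpha).
Local Notation X := (X e phi alpha).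
Local Notation sc := (pconst rel).
Local Notation tentry := (@tentry K A n e phi alpha).
Local Notation vdb := (@vdb_bracket K A n e db phi alpha).
Local Notation flip := (@flip_gen K A n phi alpha).
Local Notation sg := (@sgn_gen K A n e phi alpha).
Local Notation br := (@sp_bracket K A n e db phi alpha).
Implicit Types (g h : gens) (d : tensor A A).
Hypothesis alpha_even : forall s, ~~ odd (alpha s).
Hypothesis db_double : is_double_bracket e db.
Hypothesis phi_compat : compatible_anti_involution e db phi.
Let tauK := tau_idxK alpha_even.

Definition tentry3 (t : ttensor A) p q r s u v : O :=
  tlift (fun d z => tentry d p q r s * X z u v) t.

Let tentry3_bilinear p q r s u v :
  (forall z, linear (fun d => tentry d p q r s * X z u v)) *
  (forall d, linear (fun z => tentry d p q r s * X z u v)).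
Proof.
split=> [z|d] c x y; first by rewrite tentry_linear mulrDl -pscalerAl.
by rewrite X_linear mulrDr -pscalerAr.
Qed.

Lemma tentry3_linear p q r s u v : linear (fun t => tentry3 t p q r s u v).
Proof. by apply: tlift_is_linear; case: (tentry3_bilinear p q r s u v). Qed.

Lemma tentry3_tens d z p q r s u v :
  tentry3 (d \ox z) p q r s u v = tentry d p q r s * X z u v.
Proof. by apply: tliftE; case: (tentry3_bilinear p q r s u v). Qed.

Let tau_inner_bilinear (z : A) :
  (forall y, linear (fun x : A => (z \ox x) \ox y : ttensor A)) *
  (forall x, linear (fun y : A => (z \ox x) \ox y : ttensor A)).
Proof.
split=> [y|x] c a b; last exact: tens_linear_r.
by rewrite tens_linear_r tens_linear_l.
Qed.

Let tau_inner_linear (z : A) :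
  linear (tlift (fun x y : A => (z \ox x) \ox y : ttensor A)).
Proof. by apply: tlift_is_linear; case: (tau_inner_bilinear z). Qed.

Let tau_inner_tens (z x y : A) :
  tlift (fun x y : A => (z \ox x) \ox y : ttensor A) (x \ox y) = (z \ox x) \ox y.
Proof. by apply: tliftE; case: (tau_inner_bilinear z). Qed.

Let tau_outer_linear (d : tensor A A) :
  linear (fun z : A => tlift (fun x y : A => (z \ox x) \ox y : ttensor A) d).
Proof.
move=> c a b; move: d; apply: tensor_ext.
- exact: tau_inner_linear.
- apply: linear_addf; last exact: tau_inner_linear.
  by move=> k x y; rewrite tau_inner_linear !scalerDr !scalerA mulrC.
- by move=> x y; rewrite !tau_inner_tens tens_linear_l tens_linear_l.
Qed.

Lemma tau123_linear : linear (@tau123 K A).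
Proof.
apply: tlift_is_linear => [z|d]; first exact: tau_inner_linear.
exact: tau_outer_linear.
Qed.

Lemma tau123_tens (x y z : A) : tau123 ((x \ox y) \ox z) = (z \ox x) \ox y.
Proof.
rewrite /tau123 tliftE; first exact: tau_inner_tens.
  exact: tau_inner_linear.
exact: tau_outer_linear.
Qed.

Lemma tentry3_tau123 t p q r s u v :
  tentry3 (tau123 t) p q r s u v = tentry3 t r s u v p q.
Proof.
move: t; apply: tensor_ext.
- exact: linear_comp (tentry3_linear _ _ _ _ _ _) tau123_linear.
- exact: tentry3_linear.
move=> d z; move: d; apply: tensor_ext.
- apply: linear_comp (tentry3_linear _ _ _ _ _ _) _.
  exact: linear_comp tau123_linear (tens_linear_l _).
- exact: linear_comp (tentry3_linear _ _ _ _ _ _) (tens_linear_l _).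
- by move=> x y; rewrite tau123_tens !tentry3_tens !tentry_tens; ring.
Qed.

Let dbL_bilinear (a : A) :
  (forall y, linear (fun x : A => db a x \ox y : ttensor A)) *
  (forall x, linear (fun y : A => db a x \ox y : ttensor A)).
Proof.
split=> [y|x] c u v; last exact: tens_linear_r.
by rewrite (db_linear_r db_double) tens_linear_l.
Qed.

Lemma dbL_linear a : linear (dbL db a).
Proof. by apply: tlift_is_linear; case: (dbL_bilinear a). Qed.

Lemma dbL_tens a (x y : A) : dbL db a (x \ox y) = db a x \ox y.
Proof. by apply: tliftE; case: (dbL_bilinear a). Qed.

(* [{a_ij, d_(kl,uv)}] for the pre-bracket, expanded by the Leibniz rule. *)
Definition vdb_entry g d k l u v : O :=
  tlift (fun x y => vdb g (x, k, l) * X y u v + X x k l * vdb g (y, u, v)) d.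

Let vdb_entry_bilinear g k l u v :
  (forall y, linear (fun x => vdb g (x, k, l) * X y u v + X x k l * vdb g (y, u, v))) *
  (forall x, linear (fun y => vdb g (x, k, l) * X y u v + X x k l * vdb g (y, u, v))).
Proof.
split=> w; apply: linear_addf => c x y.
- by rewrite (vdb_bracket_linear _ db_double) mulrDl -pscalerAl.
- by rewrite X_linear mulrDl -pscalerAl.
- by rewrite X_linear mulrDr -pscalerAr.
- by rewrite (vdb_bracket_linear _ db_double) mulrDr -pscalerAr.
Qed.

Lemma vdb_entry_linear g k l u v : linear (fun d => vdb_entry g d k l u v).
Proof. by apply: tlift_is_linear; case: (vdb_entry_bilinear g k l u v). Qed.

Lemma vdb_entry_tens g x y k l u v : vdb_entry g (x \ox y) k l u v =
  vdb g (x, k, l) * X y u v + X x k l * vdb g (y, u, v).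
Proof. by apply: tliftE; case: (vdb_entry_bilinear g k l u v). Qed.

(** [dbL] acts on the first tensor factor only, so the second Leibniz term appears as [dbL] of the
    flipped tensor. *)
Lemma vdb_entryE a i j d k l u v : vdb_entry (a, i, j) d k l u v =
  tentry3 (dbL db a d) k j i l u v + tentry3 (dbL db a (tflip d)) u j i v k l.
Proof.
move: d; apply: tensor_ext.
- exact: vdb_entry_linear.
- apply: linear_addf; first exact: linear_comp (tentry3_linear _ _ _ _ _ _) (dbL_linear a).
  apply: linear_comp (tentry3_linear _ _ _ _ _ _) _.
  exact: linear_comp (dbL_linear a) (@tflip_linear _ _).
- move=> x y; rewrite vdb_entry_tens tflip_tens !dbL_tens !tentry3_tens.
  by rewrite [X x k l * _]mulrC.
Qed.

Lemma sp_bracket_tentry g d k l u v : br (pgen rel g) (tentry d k l u v) =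
  sc 2^-1 * (vdb_entry g d k l u v + sg g * vdb_entry (flip g) d k l u v).
Proof.
have bider := sp_bracket_biderivation alpha_even db_double phi_compat.
move: d; apply: tensor_ext.
- exact: linear_comp (br_linear_r bider _) (tentry_linear _ _ _ _ _ _).
- move=> c x y; rewrite !vdb_entry_linear !palg_scaleE; ring.
- move=> x y; rewrite tentry_tens (br_leibniz_r bider) !XE.
  rewrite !sp_bracketE // /sp_bracket_gen !vdb_entry_tens !XE; ring.
Qed.

(* [{g, {h, k}}] for the pre-bracket. *)
Definition vdb_nested g h (k : gens) : O :=
  vdb_entry g (db h.1.1 k.1.1) k.1.2 h.2 h.1.2 k.2.

Lemma sp_bracket_vdb g h (k : gens) : br (pgen rel g) (vdb h k) =
  sc 2^-1 * (vdb_nested g h k + sg g * vdb_nested (flip g) h k).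
Proof. exact: sp_bracket_tentry. Qed.

(** Simultaneous flips pass through the inner bracket by [db_phi] and through the outer one by
    [vdb_bracket_flip]. *)
Lemma vdb_nested_flip g h (k : gens) :
  vdb_nested (flip g) (flip h) (flip k) = sg g * sg h * sg k * vdb_nested g h k.
Proof.
rewrite /vdb_nested /= (db_phi phi_compat).
move: (db _ _); apply: tensor_ext.
- apply: linear_comp (vdb_entry_linear _ _ _ _ _) _.
  apply: linear_comp (@tflip_linear _ _) _.
  apply: tlift_is_linear => w c x y.
    by rewrite (phi_linear phi_compat) tens_linear_l.
  by rewrite (phi_linear phi_compat) tens_linear_r.
- by move=> c x y; rewrite vdb_entry_linear mulrDr -pscalerAr.
- move=> x y; rewrite tliftE => [|w|w] //; last first.
  + by move=> c ? ?; rewrite (phi_linear phi_compat) tens_linear_r.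
  + by move=> c ? ?; rewrite (phi_linear phi_compat) tens_linear_l.
  rewrite tflip_tens !vdb_entry_tens.
  have E (z : A) p q : (phi z, tau_idx p, tau_idx q) = flip (z, q, p) by [].
  rewrite !E !(vdb_bracket_flip alpha_even phi_compat) !X_phi !mxE !tauK.
  rewrite /sgn_gen /= /sgn2 !sgn_tau //; ring.
Qed.

Definition vdb_jacobiator g h (k : gens) : O :=
  vdb_nested g h k + vdb_nested h k g + vdb_nested k g h.

(** Inner and outer averaging give four terms for each of the three nested brackets. Flips that fall
    on [k] are moved away, so that only flips of [g] and [h] remain and the terms regroup into
    Jacobiators of the pre-bracket. *)
Lemma sp_jacobiatorE g h (k : gens) :
  jacobiator br (pgen rel g) (pgen rel h) (pgen rel k) =
  sc 2^-1 * sc 2^-1 *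
  (vdb_jacobiator g h k + sg g * vdb_jacobiator (flip g) h k
   + sg h * vdb_jacobiator g (flip h) k
   + sg g * sg h * vdb_jacobiator (flip g) (flip h) k).
Proof.
have bider := sp_bracket_biderivation alpha_even db_double phi_compat.
have brZ x y z : br x (sc y * z) = sc y * br x z.
  by rewrite -palg_scaleE (linear_scale (br_linear_r bider x)).
have brS x g' z : br x (sg g' * z) = sg g' * br x z.
  rewrite /sgn_gen -(rmorph_sgn2 (pconst rel)); exact: brZ.
have brD x y z : br x (y + z) = br x y + br x z.
  exact: linear_add (br_linear_r bider x) _ _.
rewrite /jacobiator !sp_bracketE // /sp_bracket_gen.
have -> : sg k * vdb (flip k) g = sg g * vdb k (flip g).
  rewrite (vdb_bracket_flipC alpha_even phi_compat k g).
  rewrite (_ : _ * (_ * _ * _) = sg g * sg g * (sg k * vdb (flip k) g)); last by ring.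
  by rewrite sgn_gen_sqr mul1r.
rewrite !brZ !brD !brS !sp_bracket_vdb.
(* In the bracket nested as k, g, h the outer flip falls on [k]; flipping all three arguments moves
   it to [g] and [h]. *)
have F g' h' k' : vdb_nested (flip k') g' h' =
    sg k' * sg g' * sg h' * vdb_nested k' (flip g') (flip h').
  rewrite -{1}(flip_genK alpha_even phi_compat g') -{1}(flip_genK alpha_even phi_compat h').
  by rewrite vdb_nested_flip !sgn_gen_flip.
have gg := sgn_gen_sqr e phi g; have hh := sgn_gen_sqr e phi h.
have kk := sgn_gen_sqr e phi k.
have E1 : sg k * vdb_nested (flip k) g h = sg g * sg h * vdb_nested k (flip g) (flip h).
  rewrite F -[RHS]mul1r -kk; ring.
have E2 : sg g * (sg k * vdb_nested (flip k) (flip g) h) = sg h * vdb_nested k g (flip h).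
  rewrite F (flip_genK alpha_even phi_compat) sgn_gen_flip // -[RHS]mul1r -[RHS]mul1r.
  rewrite -{1}kk -gg; ring.
rewrite /vdb_jacobiator !mulrDr.
rewrite E1 [sg g * (_ * (sg k * _))]mulrCA E2; ring.
Qed.

Hypothesis db_qP : is_double_quasi_poisson e db.

Definition block_commutator g : 'M[O]_N :=
  block_part (commutator_mx g.1.2 g.2 (X g.1.1)).

(** For each [s] the eight terms are those of [mxtrace_commutator3]; summing over [s] amounts to
    taking diagonal blocks. *)
Lemma tentry3_triple a b c i j k l u v :
  tentry3 (triple_bracket db a b c) u j i l k v =
  sc 4^-1 * \tr (block_commutator (a, i, j) *m block_commutator (b, k, l)
                 *m block_commutator (c, u, v)).
Proof.
case: db_qP => _ ->; rewrite (linear_scale (tentry3_linear _ _ _ _ _ _)) palg_scaleE.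
congr (_ * _); rewrite (linear_big (tentry3_linear _ _ _ _ _ _)).
rewrite mxtrace_block_part3; apply: eq_bigr => s _.
have lt := tentry3_linear u j i l k v.
rewrite mxtrace_commutator3 ?idem_mxK //.
have tD (x y : ttensor A) : tentry3 (x + y) u j i l k v =
    tentry3 x u j i l k v + tentry3 y u j i l k v.
  exact: linear_add lt x y.
have tN (x : ttensor A) : tentry3 (- x) u j i l k v = - tentry3 x u j i l k v.
  exact: linear_opp lt x.
rewrite !(tD, tN).
by rewrite !tentry3_tens !tentry_tens !XM !X_idem.
Qed.

(** By [vdb_entryE] the Jacobiator has six terms: three form the triple bracket of a, b, c, and
    antisymmetry turns the others into minus that of a, c, b. These are the two cyclic orders in
    [triple_trace]. *)
Lemma vdb_jacobiatorE g h (k : gens) : vdb_jacobiator g h k = sc 4^-1 *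
  triple_trace (block_commutator g) (block_commutator h) (block_commutator k).
Proof.
rewrite /triple_trace.
case: g h k => [[a i] j] [[b k] l] [[c u] v].
rewrite mulrBr; transitivity (tentry3 (triple_bracket db a b c) u j i l k v
    - tentry3 (triple_bracket db a c b) k j i v u l); last first.
  by congr (_ - _); exact: tentry3_triple.
rewrite /triple_bracket.
have lt p q r s t w := tentry3_linear p q r s t w.
rewrite !(linear_add (lt _ _ _ _ _ _)) !tentry3_tau123.
have G x (y z : A) p q r s t w : tentry3 (dbL db x (tflip (db y z))) p q r s t w =
   - tentry3 (dbL db x (db z y)) p q r s t w.
  rewrite -(linear_opp (lt p q r s t w)) -(linear_opp (dbL_linear x)).
  by rewrite [db z y](db_antisym db_double) opprK.
rewrite /vdb_jacobiator /vdb_nested /= !vdb_entryE !G; ring.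
Qed.

End Jacobiator.

(** * Dual bases of the symplectic Lie algebra *)

Lemma det_mx33 (B : comPzRingType) (M : 'M[B]_3) :
  let m i j := M (inord i) (inord j) in
  \det M = m 0%N 0%N * m 1%N 1%N * m 2%N 2%N - m 0%N 0%N * m 1%N 2%N * m 2%N 1%N
         - m 0%N 1%N * m 1%N 0%N * m 2%N 2%N + m 0%N 1%N * m 1%N 2%N * m 2%N 0%N
         + m 0%N 2%N * m 1%N 0%N * m 2%N 1%N - m 0%N 2%N * m 1%N 1%N * m 2%N 0%N.
Proof.
move=> m.
have mE i j : M i j = m i j by rewrite /m !inord_val.
rewrite (expand_det_row _ ord0) !big_ord_recl big_ord0 /cofactor.
rewrite !(expand_det_row _ ord0) !big_ord_recl !big_ord0 /cofactor.
rewrite !det_mx11 !mxE !mE /= /bump /=.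
by rewrite !(expr0, expr1, exprS) /=; ring.
Qed.

Section DualBases.
Variables (K : numFieldType) (n : nat) (alpha : 'I_n -> nat).
Local Notation N := (\sum_(s < n) alpha s)%N.
Hypothesis alpha_even : forall s, ~~ odd (alpha s).
Variables (d : nat) (F F' : d.-tuple 'M[K]_N).
Hypothesis FF' : dual_bases (@in_sp n alpha K) F F'.
Let tauK := tau_idxK alpha_even.

Lemma dual_basis_sp a : in_sp (tnth F a).
Proof. by case: FF' => _ -> _ _; exact/memv_span/mem_tnth. Qed.

Lemma dual_basis_sp' a : in_sp (tnth F' a).
Proof. by case: FF'. Qed.

Let two_neq0 : (2%:R != 0 :> K). Proof. by rewrite Num.Theory.pnatr_eq0. Qed.

(* The kernel of the orthogonal projection of [gl_N] onto [sp_alpha].       *)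
Definition sp_kernel (p q r s : 'I_N) : K :=
  2^-1 * (if tagnat.sig1 p == tagnat.sig1 q
          then ((p == s) && (q == r))%:R
               - sgn2 K p q * ((tau_idx q == s) && (tau_idx p == r))%:R
          else 0).

Lemma sp_kernelC p q r s : sp_kernel p q r s = sp_kernel r s p q.
Proof.
rewrite /sp_kernel; congr (_ * _).
have E : (tau_idx q == s) && (tau_idx p == r) = (tau_idx s == q) && (tau_idx r == p).
  rewrite [tau_idx q == s](can2_eq tauK tauK) [tau_idx p == r](can2_eq tauK tauK).
  by rewrite [q == _]eq_sym [p == _]eq_sym.
rewrite [(r == q) && _]andbC [s == p]eq_sym [r == q]eq_sym -E.
case: (altP andP) => [[/eqP ps /eqP qr]|_].
  by rewrite ps qr [tagnat.sig1 r == _]eq_sym [sgn2 K s r]sgn2C.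
case: (altP andP) => [[/eqP <- /eqP <-]|_]; last by rewrite !mulr0 !subrr !if_same.
by rewrite !sig1_tau // eq_sym sgn2_tau // sgn2C.
Qed.

Let mxtrace_mul_delta (M : 'M[K]_N) r s : \tr (delta_mx s r *m M) = M r s.
Proof.
rewrite -[delta_mx s r]mul1mx /mxtrace (bigD1 s) //= mul_mx_delta mxE eqxx mul1r.
rewrite [X in _ + X]big1 ?addr0 // => i /negPf si.
by rewrite mul_mx_delta mxE si mul0r.
Qed.

(** The tensor of dual bases does not depend on the bases: it represents the orthogonal projection
    onto the Lie algebra. *)
Lemma dual_bases_kernel p q r s :
  \sum_a tnth F a p q * tnth F' a r s = sp_kernel p q r s.
Proof.
(* [Q] is the projection of an elementary matrix. Its trace pairing with [F'] at [a] is an entry of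
   that matrix, so expanding [Q] in the basis [F] produces the sum. *)
pose M : 'M[K]_N := block_part (delta_mx s r).
pose Q := 2^-1 *: (M - tau_mx M).
have Qsp : in_sp Q.
  apply/(in_spP alpha_even); split.
    move=> i j /negPf ij.
    by rewrite !mxE !sig1_tau // ij [tagnat.sig1 j == _]eq_sym ij mulr0 subr0 mulr0.
  apply/matrixP=> i j; rewrite !mxE !tauK sgn2_tau // [sgn2 K j i]sgn2C.
  have := sgn2_sqr K i j; rewrite !sig1_tau //.
  move: (sgn2 K i j) => x xx.
  set y := (if _ then _ else _ : K); set z := (if _ then _ else _ : K).
  by rewrite -[X in _ = - (_ * (X - _))]mul1r -xx; ring.
have tauF a : tau_mx (tnth F' a) = - tnth F' a.
  by case/(in_spP alpha_even): (dual_basis_sp' a).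
have blkF a : block_diagonal (tnth F' a).
  by case/(in_spP alpha_even): (dual_basis_sp' a).
have trQ a : \tr (Q *m tnth F' a) = tnth F' a r s.
  have E : \tr (tau_mx M *m tnth F' a) = - \tr (M *m tnth F' a).
    rewrite -mxtrace_tau // tau_mxM // tau_mxK // tauF mulNmx raddfN /=.
    by rewrite mxtrace_mulC.
  have <- : \tr (M *m tnth F' a) = tnth F' a r s.
    rewrite -mxtrace_mul_delta /mxtrace; apply: eq_bigr => i _.
    rewrite !mxE; apply: eq_bigr => j _; rewrite [M _ _]mxE.
    case: eqP => // /eqP ij; rewrite (blkF a j i) ?mulr0 //.
    by rewrite eq_sym.
  rewrite -scalemxAl mulmxBl mxtraceZ raddfB /= E opprK -mulr2n.
  by rewrite -[\tr _ *+ 2]mulr_natl mulrA mulVf ?mul1r.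
have Qspan : Q \in <<F>>%VS by case: FF' => _ <-.
have QE := coord_span Qspan.
have FFd a b : \tr (tnth F a *m tnth F' b) = (a == b)%:R by case: FF'.
have cE b : coord F b Q = tnth F' b r s.
  rewrite -trQ {2}QE mulmx_suml raddf_sum /= (bigD1 b) //=.
  rewrite [X in _ + X]big1 ?addr0 => [|a ab].
    by rewrite -scalemxAl mxtraceZ -tnth_nth FFd eqxx mulr1.
  by rewrite -scalemxAl mxtraceZ -tnth_nth FFd (negPf ab) mulr0.
transitivity (Q p q).
  rewrite {1}QE summxE; apply: eq_bigr => a _.
  by rewrite mxE cE -tnth_nth mulrC.
rewrite /Q /sp_kernel !mxE !sig1_tau // [tagnat.sig1 q == _]eq_sym.
by case: ifP; rewrite ?mulr0 ?subr0 ?mulr0.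
Qed.

Lemma dual_bases_kernel' p q r s :
  \sum_a tnth F' a p q * tnth F a r s = sp_kernel p q r s.
Proof.
rewrite sp_kernelC -dual_bases_kernel; apply: eq_bigr => a _; exact: mulrC.
Qed.

Section Projection.
Variables (B : comPzRingType) (f : {rmorphism K -> B}).

(** The orthogonal projection onto the Lie algebra, with scalars extended to [B]: among
    block-diagonal matrices, the Lie algebra is the (-1)-eigenspace of [tau_mx]. *)
Definition sp_part (M : 'M[B]_N) : 'M[B]_N :=
  f 2^-1 *: (block_part M - tau_mx (block_part M)).

Let kernel_sum (M : 'M[B]_N) p q :
  \sum_r \sum_s M s r * f (sp_kernel p q r s) = sp_part M p q.
Proof.
rewrite (bigD1 q) //= (bigD1 p) //= /sp_kernel /sp_part !mxE !sig1_tau //.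
rewrite [tagnat.sig1 q == _]eq_sym; case: ifP => [pq|_]; last first.
  rewrite !mulr0 rmorph0 mulr0 add0r big1 ?add0r => [|s _]; last by rewrite mulr0.
  by rewrite big1 ?mulr0 ?sub0r ?oppr0 ?mulr0 // => r _; apply: big1 => s _; rewrite mulr0.
have E : \sum_r \sum_s M s r * f (2^-1 * (((p == s) && (q == r))%:R
     - sgn2 K p q * ((tau_idx q == s) && (tau_idx p == r))%:R)) =
   f 2^-1 * (M p q - sgn2 B p q * M (tau_idx q) (tau_idx p)).
  have G (x y : 'I_N) : \sum_r \sum_s M s r * ((x == s) && (y == r))%:R = M x y.
    rewrite (bigD1 y) //= (bigD1 x) //= !eqxx mulr1.
    rewrite [X in _ + X + _]big1 ?addr0 => [|s sx]; last by rewrite [x == s]eq_sym (negPf sx) mulr0.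
    rewrite [X in _ + X]big1 ?addr0 // => r ry; apply: big1 => s _.
    by rewrite [y == r]eq_sym (negPf ry) andbF mulr0.
  rewrite -(G p q) -[in RHS](G (tau_idx q) (tau_idx p)) mulr_sumr -sumrB mulr_sumr.
  apply: eq_bigr => r _; rewrite mulr_sumr -sumrB mulr_sumr; apply: eq_bigr => s _.
  by rewrite rmorphM rmorphB rmorphM !rmorph_nat rmorph_sgn2; ring.
by rewrite -E [RHS](bigD1 q) //= [in RHS](bigD1 p).
Qed.

Lemma sp_partE (M : 'M[B]_N) :
  \sum_a \tr (map_mx f (tnth F a) *m M) *: map_mx f (tnth F' a) = sp_part M.
Proof.
apply/matrixP=> p q; rewrite -kernel_sum summxE.
transitivity (\sum_a \sum_r \sum_s M s r * f (tnth F' a p q * tnth F a r s)).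
  apply: eq_bigr => a _; rewrite !mxE mulr_suml; apply: eq_bigr => r _.
  rewrite mxE mulr_suml; apply: eq_bigr => s _.
  by rewrite mxE rmorphM; ring.
rewrite exchange_big; apply: eq_bigr => r _.
rewrite exchange_big; apply: eq_bigr => s _.
by rewrite -mulr_sumr -rmorph_sum dual_bases_kernel'.
Qed.

Lemma sp_partE' (M : 'M[B]_N) :
  \sum_a \tr (map_mx f (tnth F' a) *m M) *: map_mx f (tnth F a) = sp_part M.
Proof.
apply/matrixP=> p q; rewrite -kernel_sum summxE.
transitivity (\sum_a \sum_r \sum_s M s r * f (tnth F a p q * tnth F' a r s)).
  apply: eq_bigr => a _; rewrite !mxE mulr_suml; apply: eq_bigr => r _.
  rewrite mxE mulr_suml; apply: eq_bigr => s _.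
  by rewrite mxE rmorphM; ring.
rewrite exchange_big; apply: eq_bigr => r _.
rewrite exchange_big; apply: eq_bigr => s _.
by rewrite -mulr_sumr -rmorph_sum dual_bases_kernel.
Qed.

End Projection.

End DualBases.

(** * The quasi-Poisson property *)

Section CartanTrivector.
Variables (K : numFieldType) (G : choiceType).
Variable rel : pterm K G -> pterm K G -> Prop.
Local Notation O := (palg rel).
Local Notation sc := (pconst rel).
Variables (N d : nat) (inf : 'M[K]_N -> O -> O) (F F' : d.-tuple 'M[K]_N).

Definition gradient (f : O) : 'M[O]_N :=
  \sum_(a < d) inf (tnth F a) f *: map_mx sc (tnth F' a).

Lemma mxtrace_coefs (u v w : 'I_d -> O) :
  let S x := \sum_a x a *: map_mx sc (tnth F' a) in
  \sum_a \sum_b \sum_c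
     sc (\tr (tnth F' a *m mx_comm (tnth F' b) (tnth F' c))) * (u a * v b * w c) =
  \tr (S u *m (S v *m S w - S w *m S v)).
Proof.
move=> S; rewrite /S mulmx_suml raddf_sum /=; apply: eq_bigr => a _.
rewrite mulmx_suml [X in _ - X]mulmx_sumr -sumrB mulmx_sumr raddf_sum /=.
apply: eq_bigr => b _.
rewrite mulmx_sumr mulmx_suml -sumrB mulmx_sumr raddf_sum /=.
apply: eq_bigr => c _.
rewrite -!(scalemxAl, scalemxAr) -!map_mxM !scalerA [w c * v b]mulrC.
rewrite -scalerBr -map_mxB -!(scalemxAl, scalemxAr) -map_mxM !mxtraceZ trace_map_mx.
by rewrite mulrC !mulrA.
Qed.

(** Contracting the structure constants with derivatives gives a trace of gradients
    ([mxtrace_coefs]), and alternation contributes a factor six. *)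
Lemma cartan_trivectorE (f1 f2 f3 : O) :
  cartan_trivector inf F F' f1 f2 f3 = sc 2^-1 *
    triple_trace (gradient f1) (gradient f2) (gradient f3).
Proof.
rewrite /triple_trace.
pose u a := inf (tnth F a) f1; pose v a := inf (tnth F a) f2.
pose w a := inf (tnth F a) f3.
pose tri x y z : O := \sum_(a < d) \sum_(b < d) \sum_(c < d)
   sc (\tr (tnth F' a *m mx_comm (tnth F' b) (tnth F' c))) * (x a * y b * z c).
rewrite /cartan_trivector palg_scaleE.
have -> : \sum_(a < d) \sum_(b < d) \sum_(c < d)
    \tr (tnth F' a *m mx_comm (tnth F' b) (tnth F' c)) *:
    (\sum_(s : 'S_3) (-1) ^+ s *
      \prod_(k < 3) inf (tnth [tuple tnth F a; tnth F b; tnth F c] (s k))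
                        (tnth [tuple f1; f2; f3] k)) =
  \sum_(a < d) \sum_(b < d) \sum_(c < d)
   sc (\tr (tnth F' a *m mx_comm (tnth F' b) (tnth F' c))) *
     (u a * v b * w c - u a * w b * v c - v a * u b * w c + w a * u b * v c
      + v a * w b * u c - w a * v b * u c).
  apply: eq_bigr => a _; apply: eq_bigr => b _; apply: eq_bigr => c _.
  rewrite palg_scaleE; congr (_ * _).
  (* The signed sum over permutations is the determinant of this matrix of derivatives. *)
  pose m := \matrix_(k < 3, l < 3) inf (tnth [tuple tnth F a; tnth F b; tnth F c] l)
                        (tnth [tuple f1; f2; f3] k).
  transitivity (\det m).
    by apply: eq_bigr => s _; congr (_ * _); apply: eq_bigr => k _; rewrite mxE.
  rewrite det_mx33 !mxE !(tnth_nth 0) /= !inordK //=.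
  rewrite /u /v /w !(tnth_nth 0); ring.
transitivity (sc 12^-1 * (tri u v w - tri u w v - tri v u w + tri w u v
                        + tri v w u - tri w v u)).
  congr (_ * _); rewrite /tri -!sumrB -!big_split -sumrB /=; apply: eq_bigr => a _.
  rewrite -!sumrB -!big_split -sumrB /=; apply: eq_bigr => b _.
  rewrite -!sumrB -!big_split -sumrB /=; apply: eq_bigr => c _.
  ring.
rewrite /tri !mxtrace_coefs -!/(gradient _).
set U := gradient f1; set V := gradient f2; set W := gradient f3.
have T (x y z : 'M[O]_N) : \tr (x *m (y *m z - z *m y)) = \tr (x *m y *m z) - \tr (x *m z *m y).
  by rewrite mulmxBr raddfB /= !mulmxA.
have C (x y z : 'M[O]_N) : \tr (x *m y *m z) = \tr (y *m z *m x).
  by rewrite -mulmxA mxtrace_mulC.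
rewrite !T (C V W U) (C W U V) (C W V U) (C V U W).
(* By cyclicity the six orderings give six copies of one triple trace, and 6 / 12 = 1 / 2. *)
have E : sc 12^-1 * 6%:R = sc 2^-1.
  rewrite -(rmorph_nat (pconst rel)) -rmorphM; congr (sc _).
  by field.
rewrite -E; ring.
Qed.

Hypothesis inf_der : forall a, derivation_along id (inf (tnth F a)).

Lemma gradientD f g : gradient (f + g) = gradient f + gradient g.
Proof.
rewrite -big_split; apply: eq_bigr => a _ /=.
by rewrite (der_add (inf_der a)) scalerDl.
Qed.

Lemma gradient_const c : gradient (sc c) = 0.
Proof.
by apply: big1 => a _; rewrite (der_const (inf_der a)) scale0r.
Qed.

Lemma gradientM f g : gradient (f * g) = f *: gradient g + g *: gradient f.
Proof.
rewrite !scaler_sumr -big_split; apply: eq_bigr => a _ /=.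
rewrite (der_mul (inf_der a)) !scalerA -scalerDl /=.
by congr (_ *: _); rewrite addrC [g * _]mulrC.
Qed.

Lemma cartan_trivector_der :
  [/\ forall f1 f2, derivation_along id (cartan_trivector inf F F' f1 f2),
      forall f1 f3, derivation_along id (fun f2 => cartan_trivector inf F F' f1 f2 f3)
    & forall f2 f3, derivation_along id (fun f1 => cartan_trivector inf F F' f1 f2 f3)].
Proof.
split=> f g; split=> [x y|c|x y]; rewrite !cartan_trivectorE /triple_trace;
  rewrite ?gradientD ?gradient_const ?gradientM.
- rewrite !(mulmxDl, mulmxDr) !raddfD /=; ring.
- by rewrite !(mulmx0, mul0mx) !mxtrace0 subrr mulr0.
- rewrite !(mulmxDl, mulmxDr) -!(scalemxAl, scalemxAr) !raddfD /= !mxtraceZ; ring.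
- rewrite !(mulmxDl, mulmxDr) !raddfD /=; ring.
- by rewrite !(mulmx0, mul0mx) !mxtrace0 subrr mulr0.
- rewrite !(mulmxDl, mulmxDr) -!(scalemxAl, scalemxAr) !raddfD /= !mxtraceZ; ring.
- rewrite !(mulmxDl, mulmxDr) !raddfD /=; ring.
- by rewrite !(mulmx0, mul0mx) !mxtrace0 subrr mulr0.
- rewrite !(mulmxDl, mulmxDr) -!(scalemxAl, scalemxAr) !raddfD /= !mxtraceZ; ring.
Qed.

End CartanTrivector.

Section QuasiPoisson.
Variables (K : numFieldType) (A : algType K) (n : nat) (e : 'I_n -> A).
Variables (db : A -> A -> tensor A A) (phi : A -> A) (alpha : 'I_n -> nat).
Local Notation N := (\sum_(s < n) alpha s)%N.
Local Notation gens := (A * 'I_N * 'I_N)%type.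
Local Notation O := (rep_coord e phi alpha).
Local Notation rel := (@rep_rel K A n e phi alpha).
Local Notation X := (X e phi alpha).
Local Notation sc := (pconst rel).
Local Notation flip := (@flip_gen K A n phi alpha).
Local Notation sg := (@sgn_gen K A n e phi alpha).
Local Notation br := (@sp_bracket K A n e db phi alpha).
Local Notation P := (@block_commutator K A n e phi alpha).
Implicit Types (g h : gens).
Hypothesis alpha_even : forall s, ~~ odd (alpha s).
Hypothesis phi_compat : compatible_anti_involution e db phi.
Hypothesis db_qP : is_double_quasi_poisson e db.
Let db_double : is_double_bracket e db. Proof. by case: db_qP. Qed.

Lemma tau_block_commutator g : tau_mx (P g) = - sg g *: P (flip g).
Proof.
rewrite tau_mx_block_part // tau_mx_commutator // /block_commutator X_phi.
by apply/matrixP=> i j; rewrite !mxE; case: ifP; rewrite ?mulr0.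
Qed.

Lemma sp_part_commutator g :
  sp_part sc (commutator_mx g.1.2 g.2 (X g.1.1)) =
  sc 2^-1 *: (P g + sg g *: P (flip g)).
Proof. by rewrite /sp_part -/(P g) tau_block_commutator scaleNr opprK. Qed.

Lemma mxtrace_mul_commutator (M Q : 'M[O]_N) i j :
  \tr (Q *m commutator_mx i j M) = (M *m Q - Q *m M) i j.
Proof.
have E (Z : 'M[O]_N) : \tr (Z *m delta_mx j i) = Z i j.
  rewrite -[Z *m _]mulmx1 /mxtrace (bigD1 i) //= mul_mx_delta mxE eqxx mulr1.
  rewrite [X in _ + X]big1 ?addr0 // => k /negPf ki.
  by rewrite mul_mx_delta mxE [i == k]eq_sym ki mulr0.
rewrite /commutator_mx mulmxBr raddfB /= mxtrace_mulC -mulmxA mxtrace_mulC E.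
by rewrite mulmxA E !mxE.
Qed.

Section Bases.
Variables (d : nat) (F F' : d.-tuple 'M[K]_N).
Hypothesis FF' : dual_bases (@in_sp n alpha K) F F'.
Local Notation inf := (@rep_inf K A n e phi alpha).

Lemma rep_inf_tr xi g : in_sp xi ->
  inf xi (pgen rel g) = \tr (map_mx sc xi *m commutator_mx g.1.2 g.2 (X g.1.1)).
Proof.
case: g => [[a i] j] xi_sp; rewrite -XE rep_inf_X //.
by rewrite mxtrace_mul_commutator.
Qed.

(** The derivative of a generator along [xi] is the trace pairing of [xi] with its commutator
    matrix, so contraction with the dual bases projects this matrix. *)
Lemma gradient_gen g :
  gradient inf F F' (pgen rel g) = sc 2^-1 *: (P g + sg g *: P (flip g)).
Proof.
rewrite -sp_part_commutator -(sp_partE alpha_even FF'); apply: eq_bigr => a _.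
by rewrite rep_inf_tr //; exact: dual_basis_sp FF' a.
Qed.

Lemma sp_bracket_jacobi (f g h : O) :
  br f (br g h) + br g (br h f) + br h (br f g) =
  2^-1 *: cartan_trivector inf F F' f g h.
Proof.
have bider := sp_bracket_biderivation alpha_even db_double phi_compat.
have inf_der a : derivation_along id (inf (tnth F a)).
  by apply: rep_inf_derivation => //; exact: dual_basis_sp FF' a.
have [T3 T2 T1] := cartan_trivector_der F' inf_der.
have scale_der (D : O -> O) c : derivation_along id D ->
    derivation_along id (fun x => c *: D x).
  case=> DD Dc DM; split=> *; rewrite !palg_scaleE ?DD ?Dc ?DM /= ?mulr0 //; ring.
have jac_der := jacobiator_der bider.
rewrite -/(jacobiator br f g h); move: f g h; apply: triderivation_ext.
- exact: jac_der.
- move=> x z; have := jac_der z x; case=> ? ? ?.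
  by split=> *; rewrite ![jacobiator _ x _ _]jacobiatorC ![jacobiator _ _ z _]jacobiatorC.
- move=> y z; have := jac_der y z; case=> ? ? ?.
  by split=> *; rewrite ![jacobiator _ _ y z]jacobiatorC.
- by move=> x y; apply/scale_der/T3.
- by move=> x y; apply: scale_der; exact: T2.
- by move=> x y; apply: scale_der; exact: T1.
move=> a b c; rewrite (sp_jacobiatorE alpha_even db_double phi_compat).
rewrite !(vdb_jacobiatorE phi db_double db_qP).
rewrite palg_scaleE cartan_trivectorE !gradient_gen.
have h4 : sc 4^-1 = sc 2^-1 * sc 2^-1 by rewrite -rmorphM; congr (sc _); field.
have h2 : sc 2^-1 * 2%:R = 1.
  by rewrite -(rmorph_nat (pconst rel)) -rmorphM mulVf ?rmorph1 // Num.Theory.pnatr_eq0.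
have tauP x : tau_mx (P (flip x)) = - sg x *: P x.
  rewrite tau_block_commutator (sgn_gen_flip e phi alpha_even).
  by rewrite (flip_genK alpha_even phi_compat).
have E : triple_trace (sc 2^-1 *: (P a + sg a *: P (flip a)))
    (sc 2^-1 *: (P b + sg b *: P (flip b))) (sc 2^-1 *: (P c + sg c *: P (flip c)))
  = sc 2^-1 * sc 2^-1 * sc 2^-1 * 2%:R *
    (triple_trace (P a) (P b) (P c) + sg a * triple_trace (P (flip a)) (P b) (P c)
     + sg b * triple_trace (P a) (P (flip b)) (P c)
     + sg a * sg b * triple_trace (P (flip a)) (P (flip b)) (P c)).
  exact: (triple_trace_tau_sum alpha_even (sc 2^-1) (sgn_gen_sqr e phi a)
    (sgn_gen_sqr e phi b) (sgn_gen_sqr e phi c) (tau_block_commutator a)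
    (tau_block_commutator b) (tau_block_commutator c) (tauP a) (tauP b)).
(* The constants match: 1/4 from averaging times 1/4 from [vdb_jacobiatorE], against 1/2 from the
   quasi-Poisson identity, 1/2 from [cartan_trivectorE] and 2 / 8 from the pairing of terms. *)
rewrite E h4 {E}; move: h2.
generalize (triple_trace (P a) (P b) (P c)) (triple_trace (P (flip a)) (P b) (P c))
  (triple_trace (P a) (P (flip b)) (P c)) (triple_trace (P (flip a)) (P (flip b)) (P c)).
move=> p q r s; move: (sg a) (sg b) (sc 2^-1) => x y t h2.
by rewrite -[LHS]mul1r -[X in X * _]h2; ring.
Qed.

End Bases.
End QuasiPoisson.

(** * Invariance *)

Section SymplecticGroup.
Variables (n : nat) (alpha : 'I_n -> nat).
Local Notation N := (\sum_(s < n) alpha s)%N.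
Hypothesis alpha_even : forall s, ~~ odd (alpha s).

Lemma block_diagonalM (B : comPzRingType) (M Q : 'M[B]_N) :
  block_diagonal M -> block_diagonal Q -> block_diagonal (M *m Q).
Proof.
move=> Md Qd i j ij; rewrite mxE big1 // => r _.
case: (eqVneq (tagnat.sig1 i) (tagnat.sig1 r)) => [ir|/Md ->]; last by rewrite mul0r.
by rewrite Qd ?mulr0 // -ir.
Qed.

Lemma block_diagonal_tau (B : comPzRingType) (M : 'M[B]_N) :
  block_diagonal M -> block_diagonal (tau_mx M).
Proof.
by move=> Md i j ij; rewrite mxE Md ?mulr0 // !sig1_tau // eq_sym.
Qed.

Lemma in_Sp_mul (B : comPzRingType) (M Q : 'M[B]_N) :
  in_Sp M -> in_Sp Q -> in_Sp (M *m Q).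
Proof.
move=> /(in_SpP alpha_even)[Md Mt] /(in_SpP alpha_even)[Qd Qt].
apply/(in_SpP alpha_even); split; first exact: block_diagonalM.
by rewrite tau_mxM // mulmxA -(mulmxA _ (tau_mx M)) Mt mulmx1.
Qed.

Lemma in_Sp_map (K B : comPzRingType) (f : {rmorphism K -> B}) (M : 'M[K]_N) :
  in_Sp M -> in_Sp (map_mx f M).
Proof.
move=> /(in_SpP alpha_even)[Md Mt]; apply/(in_SpP alpha_even).
split; first exact: block_diagonal_map.
by rewrite map_tau_mx -map_mxM Mt map_mx1.
Qed.

Lemma in_Sp_inv (K : fieldType) (g : 'M[K]_N) : in_Sp g -> in_Sp (invmx g).
Proof.
move=> gSp; rewrite (Sp_invmx alpha_even gSp).
case/(in_SpP alpha_even): gSp => gd gt; apply/(in_SpP alpha_even).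
split; first exact: block_diagonal_tau.
by rewrite tau_mxK //; exact: mulmx1C.
Qed.

End SymplecticGroup.

Lemma rank_one_mul (B : comPzRingType) (m p q r : nat) (M : 'M[B]_(m, p))
    (u : 'I_p -> B) (v : 'I_q -> B) (Q : 'M[B]_(q, r)) i j :
  (M *m (\matrix_(s, t) (u s * v t)) *m Q) i j =
  (\sum_s M i s * u s) * (\sum_t v t * Q t j).
Proof.
rewrite mxE mulr_sumr; apply: eq_bigr => t _.
rewrite mxE mulrA; congr (_ * _); rewrite mulr_suml; apply: eq_bigr => s _.
by rewrite mxE mulrA.
Qed.

Section Invariance.
Variables (K : fieldType) (A : algType K) (n : nat) (e : 'I_n -> A).
Variables (db : A -> A -> tensor A A) (phi : A -> A) (alpha : 'I_n -> nat).
Local Notation N := (\sum_(s < n) alpha s)%N.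
Local Notation gens := (A * 'I_N * 'I_N)%type.
Local Notation O := (rep_coord e phi alpha).
Local Notation rel := (@rep_rel K A n e phi alpha).
Local Notation X := (X e phi alpha).
Local Notation sc := (pconst rel).
Local Notation tentry := (@tentry K A n e phi alpha).
Local Notation vdb := (@vdb_bracket K A n e db phi alpha).
Local Notation br := (@sp_bracket K A n e db phi alpha).
Implicit Types (h : gens) (d : tensor A A).
Hypothesis alpha_even : forall s, ~~ odd (alpha s).
Hypothesis db_double : is_double_bracket e db.
Hypothesis phi_compat : compatible_anti_involution e db phi.
Let bider := sp_bracket_biderivation alpha_even db_double phi_compat.

Definition vdb_mx (a : A) h : 'M[O]_N := \matrix_(i, j) vdb (a, i, j) h.

Lemma sp_bracket_mx (a : A) h : \matrix_(i, j) br (X a i j) (pgen rel h) =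
  sc 2^-1 *: (vdb_mx a h + tau_mx (vdb_mx (phi a) h)).
Proof.
by apply/matrixP=> i j; rewrite !mxE sp_bracketE.
Qed.

Lemma derivation_conj (P Q : 'M[K]_N) (M : 'M[O]_N) (D : O -> O) i j :
  derivation_along id D ->
  D ((map_mx sc P *m M *m map_mx sc Q) i j) =
  (map_mx sc P *m map_mx D M *m map_mx sc Q) i j.
Proof.
move=> dD; have D0 : D 0 = 0 by rewrite -(rmorph0 sc) (der_const dD).
have Dsum (F : 'I_N -> O) : D (\sum_k F k) = \sum_k D (F k).
  exact: (big_morph D (der_add dD) D0).
have Dl c x : D (sc c * x) = sc c * D x.
  by rewrite (der_mul dD) (der_const dD) mul0r add0r.
have Dr c x : D (x * sc c) = D x * sc c by rewrite mulrC Dl mulrC.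
rewrite mxE [RHS]mxE Dsum; apply: eq_bigr => k _.
rewrite [X in _ * X]mxE [X in _ = _ * X]mxE Dr; congr (_ * _).
rewrite mxE [RHS]mxE Dsum; apply: eq_bigr => l _.
by rewrite !mxE Dl.
Qed.

Let mx_linear (f : tensor A A -> 'M[O]_N) (P Q : 'M[O]_N) i j :
  (forall k l, linear (fun d => f d k l)) ->
  linear (fun d => (P *m f d *m Q) i j).
Proof.
move=> lf c x y; have -> : f (c *: x + y) = sc c *: f x + f y.
  by apply/matrixP=> k l; rewrite lf !mxE.
by rewrite mulmxDr mulmxDl -scalemxAr -scalemxAl !mxE.
Qed.

Section Element.
Variable g : 'M[K]_N.
Hypothesis g_Sp : in_Sp g.
Local Notation cg := (map_mx sc g).
Local Notation cg' := (map_mx sc (invmx g)).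
Local Notation act := (@rep_act K A n e phi alpha g).

(** As a function of (i, j) or of (k, l), an entry of a pure tensor is a rank-one matrix. The
    factors of the conjugations of the (k, j) and (i, l) entries thus regroup into conjugations in
    (i, j) and (k, l). *)
Lemma rep_act_tentry d k j i l : act (tentry d k j i l) =
  (cg' *m (\matrix_(p, q) (cg' *m (\matrix_(r, t) tentry d r q p t) *m cg) k l) *m cg) i j.
Proof.
have actM : {morph act : x y / x * y} by exact: rep_actM.
have actD : {morph act : x y / x + y} by exact: rep_actD.
have actC c : act (sc c) = sc c by exact: rep_act_const.
have actX c p q : act (X c p q) = (cg' *m X c *m cg) p q by exact: rep_act_X.
move: d; apply: tensor_ext.
- move=> c x y; rewrite tentry_linear actD palg_scaleE actM.
  by rewrite actC -palg_scaleE.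
- apply: mx_linear => p q; rewrite /=.
  under [X in linear X]funext => d do rewrite mxE.
  apply: mx_linear => r t.
  under [X in linear X]funext => d do rewrite mxE.
  exact: tentry_linear.
- move=> x y; rewrite tentry_tens actM !actX.
  have E : \matrix_(p, q) (cg' *m (\matrix_(r, t) tentry (x \ox y) r q p t) *m cg) k l =
     \matrix_(p, q) ((X y *m cg) p l * (cg' *m X x) k q).
    apply/matrixP=> p q; rewrite [LHS]mxE [RHS]mxE.
    have -> : \matrix_(r, t) tentry (x \ox y) r q p t = \matrix_(r, t) (X x r q * X y p t).
      by apply/matrixP=> r t; rewrite mxE [RHS]mxE tentry_tens.
    by rewrite rank_one_mul mulrC; congr (_ * _); rewrite [RHS]mxE.
  rewrite E rank_one_mul mulrC; congr (_ * _).
    by rewrite -mulmxA [LHS]mxE.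
  by rewrite [LHS]mxE.
Qed.

(* The flipped half of the bracket is invariant because [g^-1 = tau_mx g]. *)
Lemma sp_bracket_invariant (f h : O) : act (br f h) = br (act f) (act h).
Proof.
have actM : {morph act : x y / x * y} by exact: rep_actM.
have actD : {morph act : x y / x + y} by exact: rep_actD.
have actC c : act (sc c) = sc c by exact: rep_act_const.
have actX c p q : act (X c p q) = (cg' *m X c *m cg) p q by exact: rep_act_X.
have act0 : act 0 = 0 by rewrite -(rmorph0 sc) actC.
have derl y := biderivation_derl bider y; have derr y := biderivation_derr bider y.
(* As [act] is a ring morphism, both sides are derivations along it, first in [f] and then in
   [h]. *)
move: f; apply: (@derivation_ext _ _ _ _ act).
- split=> [x y|c|x y].
  + by rewrite (der_add (derl h)) actD.
  + by rewrite (der_const (derl h)) act0.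
  + by rewrite (der_mul (derl h)) actD !actM.
- split=> [x y|c|x y].
  + by rewrite actD (der_add (derl _)).
  + by rewrite actC (der_const (derl _)).
  + by rewrite actM (der_mul (derl _)).
case=> [[a i] j]; move: h; apply: (@derivation_ext _ _ _ _ act).
- split=> [x y|c|x y].
  + by rewrite (der_add (derr _)) actD.
  + by rewrite (der_const (derr _)) act0.
  + by rewrite (der_mul (derr _)) actD !actM.
- split=> [x y|c|x y].
  + by rewrite actD (der_add (derr _)).
  + by rewrite actC (der_const (derr _)).
  + by rewrite actM (der_mul (derr _)).
case=> [[b k] l].
pose W (c : A) : 'M[O]_N :=
  \matrix_(p, q) (cg' *m (\matrix_(r, t) vdb (c, p, q) (b, r, t)) *m cg) k l.
have actV c p q : act (vdb (c, p, q) (b, k, l)) = (cg' *m W c *m cg) p q.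
  exact: rep_act_tentry.
rewrite sp_bracketE // /sp_bracket_gen actM actC actD actM -!XE.
rewrite !actX.
rewrite (derivation_conj _ _ _ _ _ (derl _)).
(* The conjugation in (k, l) is absorbed into [W]; the one in (i, j) remains. *)
have -> : map_mx (br^~ ((cg' *m X b *m cg) k l)) (X a) =
          sc 2^-1 *: (W a + tau_mx (W (phi a))).
  apply/matrixP=> p q; rewrite [LHS]mxE (derivation_conj _ _ _ _ _ (derr _)).
  have -> : map_mx (br (X a p q)) (X b) =
     sc 2^-1 *: ((\matrix_(r, t) vdb (a, p, q) (b, r, t))
       + sgn2 O p q *: (\matrix_(r, t) vdb (phi a, tau_idx q, tau_idx p) (b, r, t))).
    by apply/matrixP=> r t; rewrite !mxE sp_bracketE.
  rewrite -scalemxAr -scalemxAl mulmxDr mulmxDl -!scalemxAr -!scalemxAl.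
  by rewrite !mxE; congr (_ * (_ + _ * _)); rewrite mxE.
rewrite -scalemxAr -scalemxAl mulmxDr mulmxDl [RHS]mxE [X in _ = _ * X]mxE.
rewrite !actV; congr (_ * (_ + _)).
have -> : cg' *m tau_mx (W (phi a)) *m cg = tau_mx (cg' *m W (phi a) *m cg).
  rewrite !tau_mxM // !map_tau_mx {2}(Sp_invmx alpha_even g_Sp) tau_mxK //.
  by rewrite -(Sp_invmx alpha_even g_Sp) mulmxA.
rewrite [RHS]mxE -actV; congr (_ * _).
by rewrite /sgn_gen -(rmorph_sgn2 sc) actC.
Qed.

End Element.
End Invariance.

(** * The moment map *)

Section SpCoordinates.
Variables (K : fieldType) (n : nat) (alpha : 'I_n -> nat).
Local Notation N := (\sum_(s < n) alpha s)%N.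
Local Notation S := (sp_coord K alpha).
Local Notation rel := (@sp_rel K n alpha).
Local Notation sc := (pconst rel).
Local Notation Y := (sp_mx K alpha).
Hypothesis alpha_even : forall s, ~~ odd (alpha s).

Let Omega_const : map_mx sc (Omega alpha K) = Omega alpha S.
Proof.
apply/matrixP=> i j; rewrite [LHS]mxE !OmegaE //.
by case: ifP; rewrite ?rmorph0 ?rmorph_sgn.
Qed.

Let double_sumE (B : comPzRingType) (M W Q : 'M[B]_N) i j :
  \sum_k \sum_l (M k i * W k l) * Q l j = (M^T *m W *m Q) i j.
Proof.
rewrite exchange_big mxE; apply: eq_bigr => l _ /=.
by rewrite mxE mulr_suml; apply: eq_bigr => k _; rewrite mxE.
Qed.

Lemma sp_mx_Sp : in_Sp Y.
Proof.
apply/(in_SpP alpha_even); split.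
  move=> i j ij; rewrite mxE [LHS](pgen_rel (sp_rel_block _ ij)).
  exact: (rmorph0 sc).
apply/(tau_mx_SpP alpha_even)/matrixP=> i j; rewrite -double_sumE.
have := pgen_rel (sp_rel_form K i j).
rewrite palg_of_psum big_enum -[palg_of _ (PConst _)]/(sc _) => E.
rewrite -[in RHS]Omega_const [RHS]mxE -E; apply: eq_bigr => k _.
rewrite palg_of_psum big_enum; apply: eq_bigr => l _.
by rewrite !palg_ofM -Omega_const !mxE.
Qed.

Section Morphism.
Variables (B : comPzRingType) (c : {rmorphism K -> B}) (M : 'M[B]_N).
Hypothesis M_Sp : in_Sp M.
Local Notation f := (plift c (fun p => M p.1 p.2) : S -> B).

Let lift_rel s t : rel s t ->
  peval c (fun p => M p.1 p.2) s = peval c (fun p => M p.1 p.2) t.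
Proof.
case/(in_SpP alpha_even): M_Sp => Md /(tau_mx_SpP alpha_even) Mt.
case=> {s t} [i j ij|i j] /=; first by rewrite Md // rmorph0.
have <- : map_mx c (Omega alpha K) i j = c (Omega alpha K i j) by rewrite mxE.
have E : map_mx c (Omega alpha K) = Omega alpha B.
  apply/matrixP=> k l; rewrite [LHS]mxE !OmegaE //.
  by case: ifP; rewrite ?rmorph0 ?rmorph_sgn.
rewrite E -Mt -double_sumE peval_psum big_enum; apply: eq_bigr => k _.
rewrite peval_psum big_enum; apply: eq_bigr => l _ /=.
by congr (_ * _ * _); rewrite -E [RHS]mxE.
Qed.

Lemma sp_lift_gen i j : f (Y i j) = M i j.
Proof. by rewrite mxE plift_gen. Qed.

Lemma sp_lift_const k : f (sc k) = c k.
Proof. by rewrite plift_const. Qed.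

Lemma sp_liftD : {morph f : x y / x + y}.
Proof. by case: (plift_is_morphism lift_rel). Qed.

Lemma sp_liftM : {morph f : x y / x * y}.
Proof. by case: (plift_is_morphism lift_rel). Qed.

Lemma sp_lift_mul (P Q : 'M[S]_N) i j :
  f ((P *m Q) i j) = (map_mx f P *m map_mx f Q) i j.
Proof.
rewrite !mxE (big_morph _ sp_liftD (_ : f 0 = 0)); last first.
  by rewrite -(rmorph0 sc) sp_lift_const rmorph0.
by apply: eq_bigr => k _; rewrite !mxE sp_liftM.
Qed.

Lemma map_sp_lift_mx : map_mx f Y = M.
Proof. by apply/matrixP=> i j; rewrite mxE sp_lift_gen. Qed.

Lemma map_sp_lift_const (P : 'M[K]_N) : map_mx f (map_mx sc P) = map_mx c P.
Proof. by apply/matrixP=> i j; rewrite !mxE sp_lift_const. Qed.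

Lemma map_sp_lift_mul (P Q : 'M[S]_N) :
  map_mx f (P *m Q) = map_mx f P *m map_mx f Q.
Proof. by apply/matrixP=> i j; rewrite [LHS]mxE sp_lift_mul. Qed.

End Morphism.

(** The second hypothesis is the derivative of the equation saying that [Y] preserves the symplectic
    form. *)
Lemma sp_derivation (D : 'M[S]_N) :
  block_diagonal D ->
  D^T *m Omega alpha S *m Y + Y^T *m Omega alpha S *m D = 0 ->
  forall s t, rel s t ->
    pder (palg_of rel) (fun p => D p.1 p.2) s = pder (palg_of rel) (fun p => D p.1 p.2) t.
Proof.
move=> Dd DY s t; case=> {s t} [i j ij|i j] /=; first exact: Dd.
transitivity ((D^T *m Omega alpha S *m Y + Y^T *m Omega alpha S *m D) i j); last first.
  by rewrite DY mxE.
rewrite mxE -!double_sumE pder_psum big_enum -big_split; apply: eq_bigr => k _.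
rewrite pder_psum big_enum -big_split; apply: eq_bigr => l _ /=.
by rewrite palg_ofM mulr0 addr0 -Omega_const !mxE.
Qed.

Section Fields.
Variable xi : 'M[K]_N.
Hypothesis xi_sp : in_sp xi.
Local Notation cxi := (map_mx sc xi).

Let cxi_block : block_diagonal cxi.
Proof. by apply: block_diagonal_map; case/(in_spP alpha_even): xi_sp. Qed.

Let cxi_form : cxi^T *m Omega alpha S + Omega alpha S *m cxi = 0.
Proof.
apply/(tau_mx_spP alpha_even); rewrite map_tau_mx.
by case/(in_spP alpha_even): xi_sp => _ ->; rewrite map_mxN.
Qed.

Let Y_block : block_diagonal Y.
Proof. by case/(in_SpP alpha_even): sp_mx_Sp. Qed.

Let Y_form : Y^T *m Omega alpha S *m Y = Omega alpha S.
Proof. by apply/(tau_mx_SpP alpha_even); case/(in_SpP alpha_even): sp_mx_Sp. Qed.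

Let left_rel s t : rel s t ->
  pder (palg_of rel) (fun p => (Y *m cxi) p.1 p.2) s =
  pder (palg_of rel) (fun p => (Y *m cxi) p.1 p.2) t.
Proof.
apply: sp_derivation; first exact: block_diagonalM.
by rewrite trmx_mul mulmxA Y_form -!mulmxA (mulmxA Y^T) Y_form.
Qed.

Let right_rel s t : rel s t ->
  pder (palg_of rel) (fun p => (cxi *m Y) p.1 p.2) s =
  pder (palg_of rel) (fun p => (cxi *m Y) p.1 p.2) t.
Proof.
apply: sp_derivation; first exact: block_diagonalM.
rewrite trmx_mul -!mulmxA -mulmxDr !mulmxA -mulmxDl.
by rewrite cxi_form mul0mx mulmx0.
Qed.

Lemma left_field_gen i j : left_field xi (Y i j) = (Y *m cxi) i j.
Proof. by rewrite [Y i j]mxE /left_field pderiv_gen. Qed.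

Lemma right_field_gen i j : right_field xi (Y i j) = (cxi *m Y) i j.
Proof. by rewrite [Y i j]mxE /right_field pderiv_gen. Qed.

Lemma left_field_der : derivation_along id (left_field (alpha := alpha) xi).
Proof. exact/pderiv_derivation/left_rel. Qed.

Lemma right_field_der : derivation_along id (right_field (alpha := alpha) xi).
Proof. exact/pderiv_derivation/right_rel. Qed.

End Fields.

End SpCoordinates.

Section MomentMap.
Variables (K : numFieldType) (A : algType K) (n : nat) (e : 'I_n -> A).
Variables (db : A -> A -> tensor A A) (phi : A -> A) (alpha : 'I_n -> nat).
Local Notation N := (\sum_(s < n) alpha s)%N.
Local Notation gens := (A * 'I_N * 'I_N)%type.
Local Notation O := (rep_coord e phi alpha).
Local Notation rel := (@rep_rel K A n e phi alpha).
Local Notation X := (X e phi alpha).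
Local Notation sc := (pconst rel).
Local Notation tentry := (@tentry K A n e phi alpha).
Local Notation vdb := (@vdb_bracket K A n e db phi alpha).
Local Notation br := (@sp_bracket K A n e db phi alpha).
Local Notation P := (@block_commutator K A n e phi alpha).
Local Notation E := (idem_mx alpha O).
Local Notation V := (@vdb_mx K A n e db phi alpha).
Implicit Types (h : gens).
Hypothesis alpha_even : forall s, ~~ odd (alpha s).
Hypothesis e_idem : complete_orthogonal_idempotents e.
Hypothesis db_double : is_double_bracket e db.
Hypothesis phi_compat : compatible_anti_involution e db phi.
Let bider := sp_bracket_biderivation alpha_even db_double phi_compat.

Lemma vdb_mxM a b h : V (a * b) h = V a h *m X b + X a *m V b h.
Proof.
apply/matrixP=> i j; rewrite [LHS]mxE (vdb_bracket_anti phi db_double).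
case: h => [[c k] l]; rewrite (vdb_bracketM phi db_double) opprD.
rewrite [RHS]mxE [X in _ = X + _]mxE [X in _ = _ + X]mxE -!sumrN.
congr (_ + _); apply: eq_bigr => r _.
  by rewrite -mulNr -(vdb_bracket_anti phi db_double) [V a _ _ _]mxE.
by rewrite -mulrN -(vdb_bracket_anti phi db_double) [V b _ _ _]mxE.
Qed.

Lemma vdb_mx_one h : V 1 h = 0.
Proof.
have := vdb_mxM 1 1 h; rewrite mulr1 (X_one phi alpha e_idem) mulmx1 mul1mx.
by move/(congr1 (fun M => M - V 1 h)); rewrite subrr addrK => <-.
Qed.

Lemma sum_idem_mx : \sum_s E s = 1%:M.
Proof.
rewrite -(X_one phi alpha e_idem); case: e_idem => _ <-.
apply/matrixP=> i j; rewrite summxE (linear_big (X_linear e phi i j)).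
by apply: eq_bigr => s _; rewrite X_idem.
Qed.

Variable Phi : A.
Hypothesis Phi_moment : is_double_moment_map e db Phi.
Hypothesis Phi_unitary : phi Phi * Phi = 1.

Let Phi_phi : Phi * phi Phi = 1.
Proof.
case: Phi_moment => [[Psi [PP _]] _].
by have -> : phi Phi = Psi by rewrite -[LHS]mulr1 -PP mulrA Phi_unitary mul1r.
Qed.

Lemma moment_mx_Sp : in_Sp (X Phi).
Proof.
apply/(in_SpP alpha_even); split; last first.
  by rewrite -X_phi -XM Phi_unitary (X_one phi alpha e_idem).
case: Phi_moment => _ [Phis [-> Phis_block _]] i j ij.
rewrite (linear_big (X_linear e phi i j)) [LHS]big1 // => s _.
have [a ->] := Phis_block s.
rewrite !XM X_idem mul_mx_idemE mul_idem_mxE.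
case: eqP => // js; case: eqP => // si.
by rewrite js si eqxx in ij.
Qed.

(** Multiplying [X Phi] by the s-th idempotent on either side gives [X (Phis s)]. The four terms of
    the double moment map identity are then those of a commutator cut down to block s, multiplied by
    [X Phi] on the left or right. *)
Lemma vdb_mx_moment h : V Phi h = sc 2^-1 *: (X Phi *m P h + P h *m X Phi).
Proof.
case: Phi_moment => _ [Phis [PhiE Phis_block Phis_db]].
case: h => [[b k] l].
have XPhis s : X (Phis s) = E s *m X Phi.
  rewrite -X_idem -XM; congr (X _); rewrite PhiE mulr_sumr (bigD1 s) //= big1 ?addr0.
    have [a ->] := Phis_block s; case: e_idem => ee _.
    by rewrite !mulrA ee eqxx.
  move=> t ts; have [a ->] := Phis_block t; case: e_idem => ee _.
  by rewrite !mulrA ee eq_sym (negPf ts) !mul0r.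
have XPhis' s : X (Phis s) = X Phi *m E s.
  rewrite XPhis block_diagonal_comm //.
  by case/(in_SpP alpha_even): moment_mx_Sp.
have Psum : P (b, k, l) = \sum_s E s *m commutator_mx k l (X b) *m E s.
  rewrite -[LHS]mulmx1 -sum_idem_mx mulmx_sumr; apply: eq_bigr => s _.
  exact: block_part_idem.
apply/matrixP=> i j; rewrite [LHS]mxE /vdb_bracket /= PhiE.
rewrite (linear_big (db_linear_l db_double b)) (linear_big (tentry_linear _ _ _ _ _ _)).
rewrite -PhiE Psum mulmx_sumr mulmx_suml -big_split /= mxE summxE mulr_sumr.
apply: eq_bigr => s _.
have lt := tentry_linear e phi k j i l.
rewrite Phis_db (linear_scale lt) palg_scaleE; congr (_ * _).
rewrite !(linear_add lt) !(linear_opp lt).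
rewrite !tentry_tens !XM !X_idem /commutator_mx.
rewrite !(mulmxA, mulmxBr, mulmxBl) -!XPhis' -![_ *m E s *m X Phi]mulmxA -!XPhis.
have D (M Q : 'M[O]_N) : (M *m delta_mx l k *m Q) i j = M i l * Q k j.
  exact: mul_mx_delta.
have Dsub (M Q : 'M[O]_N) : (M - Q) i j = M i j - Q i j by rewrite !mxE.
rewrite [RHS]mxE !Dsub.
rewrite -!(mulmxA _ (X b) (E s)) -!(mulmxA _ (X b) (X (Phis s))) !D.
ring.
Qed.

(** The derivative of an inverse, since [phi Phi] is inverse to [Phi]. *)
Lemma vdb_mx_moment_inv h : V (phi Phi) h = - (X (phi Phi) *m V Phi h *m X (phi Phi)).
Proof.
have E0 : V (phi Phi) h *m X Phi + X (phi Phi) *m V Phi h = 0.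
  by rewrite -vdb_mxM Phi_unitary vdb_mx_one.
move/eqP: E0; rewrite addr_eq0 => /eqP/(congr1 (fun M => M *m X (phi Phi))).
by rewrite -mulmxA -XM Phi_phi (X_one phi alpha e_idem) mulmx1 mulNmx.
Qed.

(** [tau_mx] maps [X (phi Phi)] to [X Phi], so the flipped half is the first half with [P h]
    replaced by minus [tau_mx (P h)]; adding them yields [sp_part]. *)
Lemma sp_bracket_moment h :
  \matrix_(i, j) br (X Phi i j) (pgen rel h) =
  sc 2^-1 *: (X Phi *m sp_part sc (commutator_mx h.1.2 h.2 (X h.1.1))
              + sp_part sc (commutator_mx h.1.2 h.2 (X h.1.1)) *m X Phi).
Proof.
rewrite (sp_bracket_mx alpha_even db_double phi_compat) vdb_mx_moment_inv vdb_mx_moment.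
rewrite /sp_part -/(P h).
have XX : X Phi *m X (phi Phi) = 1%:M by rewrite -XM Phi_phi (X_one phi alpha e_idem).
have XX' : X (phi Phi) *m X Phi = 1%:M.
  by rewrite -XM Phi_unitary (X_one phi alpha e_idem).
have -> : X (phi Phi) *m (sc 2^-1 *: (X Phi *m P h + P h *m X Phi)) *m X (phi Phi) =
    sc 2^-1 *: (P h *m X (phi Phi) + X (phi Phi) *m P h).
  rewrite -scalemxAr -scalemxAl mulmxDr mulmxDl !mulmxA XX' mul1mx.
  by rewrite -(mulmxA _ (X Phi)) XX mulmx1.
have tauXphi : tau_mx (X (phi Phi)) = X Phi by rewrite X_phi tau_mxK.
have -> : tau_mx (- (sc 2^-1 *: (P h *m X (phi Phi) + X (phi Phi) *m P h))) =
    - (sc 2^-1 *: (X Phi *m tau_mx (P h) + tau_mx (P h) *m X Phi)).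
  rewrite -tauXphi -!tau_mxM //.
  by apply/matrixP=> i j; rewrite !mxE; ring.
rewrite -!(scalemxAr, scalemxAl) !(mulmxBr, mulmxBl).
move: (X Phi *m P h) (P h *m X Phi) (X Phi *m tau_mx (P h)) (tau_mx (P h) *m X Phi).
by move=> x y z w; apply/matrixP=> i j; rewrite !mxE; ring.
Qed.

Lemma sp_moment_map : rep_moment_map br (X Phi).
Proof.
have XSp := moment_mx_Sp.
have pullM : {morph pullback (X Phi) : x y / x * y} by exact: sp_liftM.
have pullD : {morph pullback (X Phi) : x y / x + y} by exact: sp_liftD.
have pullC c : pullback (X Phi) (pconst _ c) = sc c by exact: sp_lift_const.
have pull0 : pullback (X Phi) 0 = 0.
  by rewrite -(rmorph0 (pconst (@sp_rel K n alpha))) pullC rmorph0.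
have pullX i j : pullback (X Phi) (sp_mx K alpha i j) = X Phi i j by exact: sp_lift_gen.
split=> // [g H gSp|d F F' FF' H f].
  have AdSp : in_Sp (sp_const (invmx g) *m sp_mx K alpha *m sp_const g).
    by do 2?apply: in_Sp_mul => //; [apply/in_Sp_map/in_Sp_inv|exact: sp_mx_Sp|exact: in_Sp_map].
  have actM : {morph rep_act (e := e) (phi := phi) g : x y / x * y} by exact: rep_actM.
  have actD : {morph rep_act (e := e) (phi := phi) g : x y / x + y} by exact: rep_actD.
  have AdM : {morph sp_Ad (alpha := alpha) g : x y / x * y} by exact: sp_liftM.
  have AdD : {morph sp_Ad (alpha := alpha) g : x y / x + y} by exact: sp_liftD.
  have AdC c : sp_Ad g (pconst (@sp_rel K n alpha) c) = pconst _ c.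
    exact: sp_lift_const.
  (* Both sides are algebra morphisms in [H], hence compared on the entries of the universal
     matrix. *)
  move: H; apply: morphism_ext.
  - by move=> x y; rewrite pullD actD.
  - by move=> x y; rewrite pullM actM.
  - by move=> x y; rewrite AdD pullD.
  - by move=> x y; rewrite AdM pullM.
  - by move=> c; rewrite AdC !pullC; exact: rep_act_const.
  - case=> i j; have -> : pgen (@sp_rel K n alpha) (i, j) = sp_mx K alpha i j by rewrite mxE.
    rewrite pullX rep_act_X // [sp_Ad _ _](sp_lift_gen alpha_even _ AdSp).
    rewrite /pullback sp_lift_mul // map_sp_lift_mul // map_sp_lift_mx //.
    by rewrite !map_sp_lift_const.
have inf_der a : derivation_along id (rep_inf (e := e) (phi := phi) (tnth F' a)).
  by apply: rep_inf_derivation => //; exact: dual_basis_sp' FF' a.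
have Fsp a : in_sp (tnth F a) by exact: dual_basis_sp FF' a.
have derl y := biderivation_derl bider y; have derr y := biderivation_derr bider y.
have fac (c s u v t : O) : c * s * u + v * (c * t) = c * (s * u + v * t) by ring.
(* Both sides are derivations in [H] along the pullback, and then derivations in [f]. *)
move: H; apply: (@derivation_ext _ _ _ _ (pullback (X Phi))).
- split=> [x y|c|x y].
  + by rewrite pullD (der_add (derl f)).
  + by rewrite pullC (der_const (derl f)).
  + by rewrite pullM (der_mul (derl f)).
- split=> [x y|c|x y]; rewrite !palg_scaleE.
  + rewrite -mulrDr -big_split; congr (_ * _); apply: eq_bigr => a _ /=.
    rewrite (der_add (left_field_der alpha_even (Fsp a))).
    by rewrite (der_add (right_field_der alpha_even (Fsp a))) !pullD addrACA mulrDl.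
  + rewrite [X in _ * X]big1 ?mulr0 // => a _.
    rewrite (der_const (left_field_der alpha_even (Fsp a))).
    by rewrite (der_const (right_field_der alpha_even (Fsp a))) addr0 pull0 mul0r.
  + rewrite /= fac; congr (_ * _); rewrite mulr_suml mulr_sumr -big_split.
    apply: eq_bigr => a _ /=.
    rewrite (der_mul (left_field_der alpha_even (Fsp a))).
    by rewrite (der_mul (right_field_der alpha_even (Fsp a))) !(pullD, pullM) /=; ring.
case=> i j; have -> : pgen (@sp_rel K n alpha) (i, j) = sp_mx K alpha i j by rewrite mxE.
move: f; apply: (@derivation_ext _ _ _ _ id); first exact: derr.
  split=> [x y|c|x y]; rewrite !palg_scaleE.
  - rewrite -mulrDr -big_split; congr (_ * _); apply: eq_bigr => a _ /=.
    by rewrite (der_add (inf_der a)) mulrDr.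
  - by rewrite [X in _ * X]big1 ?mulr0 // => a _; rewrite (der_const (inf_der a)) mulr0.
  - rewrite /= fac; congr (_ * _); rewrite mulr_suml mulr_sumr -big_split.
    apply: eq_bigr => a _ /=.
    by rewrite (der_mul (inf_der a)) /=; ring.
move=> h; rewrite pullX.
transitivity ((\matrix_(i, j) br (X Phi i j) (pgen rel h)) i j); first by rewrite mxE.
(* The projection is expanded with derivatives along [F'] and matrices from [F]: multiplying the
   latter by [X Phi] on the two sides gives the left and right invariant fields. *)
rewrite sp_bracket_moment -(sp_partE' alpha_even FF') mxE palg_scaleE; congr (_ * _).
rewrite mulmx_sumr mulmx_suml -big_split /= summxE; apply: eq_bigr => a _.
have -> : rep_inf (tnth F' a) (pgen rel h) =
    \tr (map_mx sc (tnth F' a) *m commutator_mx h.1.2 h.2 (X h.1.1)).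
  by apply: rep_inf_tr => //; exact: dual_basis_sp' FF' a.
rewrite -scalemxAr -scalemxAl -scalerDr mxE mulrC.
congr (_ * _).
rewrite left_field_gen // right_field_gen // pullD /pullback.
rewrite !(sp_lift_mul alpha_even) // map_sp_lift_mx // map_sp_lift_const //.
by rewrite mxE.
Qed.

End MomentMap.

Unset Implicit Arguments.

Theorem theorem4p7 (R : realType) (n : nat) (A : algType R[i]) (e : 'I_n -> A)
    (db : A -> A -> tensor A A) (phi : A -> A) (alpha : 'I_n -> nat)
    (A_fg : finitely_generated A)
    (e_idem : complete_orthogonal_idempotents e)
    (db_qP : is_double_quasi_poisson e db)
    (phi_compat : compatible_anti_involution e db phi)
    (alpha_even : forall s, ~~ odd (alpha s)) :
  exists br : rep_coord e phi alpha -> rep_coord e phi alpha -> rep_coord e phi alpha,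
    [/\ antisym_biderivation br,
        bracket_formula db br,
        (forall br' : rep_coord e phi alpha -> rep_coord e phi alpha ->
                      rep_coord e phi alpha,
           antisym_biderivation br' -> bracket_formula db br' -> br' =2 br),
        rep_quasi_poisson br
      & forall Phi : A, is_double_moment_map e db Phi -> phi Phi * Phi = 1 ->
          rep_moment_map br (X e phi alpha Phi)].
Proof.
have db_double : is_double_bracket e db by case: db_qP.
have bider := sp_bracket_biderivation alpha_even db_double phi_compat.
have formula := sp_bracket_formula alpha_even db_double phi_compat.
exists (@sp_bracket _ A n e db phi alpha); split=> //.
- move=> br' bider' formula'; apply: biderivation_ext => // -[[a i] j] [[b k] l].
  by rewrite -!XE formula' formula.
- split=> // [g f h gSp|d F F' FF' f g h].
    exact: sp_bracket_invariant.
  exact: sp_bracket_jacobi.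
- by move=> Phi Phi_moment Phi_unitary; exact: sp_moment_map.
Qed.
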